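(* There exist constants $c_1,c_2>0$, independent of $m$, such that for every integer $m\ge 0$ the operator norm $\|\mathcal{B}_{2m}\|_\infty$ of $\mathcal{B}_{2m}$ as a linear operator on $C(B^2\times[-1,1])$ (with the uniform norm) satisfies $$c_1\, m\,(\log(m+1))^2\ \le\ \|\mathcal{B}_{2m}\|_\infty\ \le\ c_2\, m\,(\log(m+1))^2 .$$
   Context: $B^2$ is the closed unit disk in $\mathbb{R}^2$. For $\theta\in[0,2\pi]$ and $t\in[-1,1]$ let $I(\theta;t)=\{(t\cos\theta+s\sin\theta,\ t\sin\theta-s\cos\theta): |s|\le\sqrt{1-t^2}\}$ (the chord of $B^2$ on the line $x\cos\theta+y\sin\theta=t$). For a function $g$ on $B^2$, the Radon projection $\mathcal{R}_\theta(g;t)$ is the integral of $g$ over $I(\theta;t)$ with respect to arc length; for $f$ on $B^2\times[-1,1]$, $\mathcal{R}_\theta(f(\cdot,\cdot,z);t)$ is the Radon projection of $(x,y)\mapsto f(x,y,z)$ for fixed $z$. $U_k(\cos\alpha)=\sin((k+1)\alpha)/\sin\alpha$ is the Chebyshev polynomial of the second kind; $\widetilde T_0=1$ and $\widetilde T_k(\cos\alpha)=\sqrt2\cos(k\alpha)$ for $k\ge1$. For $m\ge1$ put $\theta_j=\frac{j\pi}{2m+1}$, $z_l=\cos\gamma_l$ with $\gamma_l=\frac{2l+1}{4m}\pi$, $\phi_\nu=\frac{2\pi\nu}{2m+1}$, $\sigma_\nu(x,y)=\arccos(x\cos\phi_\nu+y\sin\phi_\nu)\in[0,\pi]$. Define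 $$\mathcal{B}_{2m}(f)(x,y,z)=\sum_{\nu=0}^{2m}\sum_{j=1}^{2m}\sum_{l=0}^{2m-1}\mathcal{R}_{\phi_\nu}(f(\cdot,\cdot,z_l);\cos\theta_j)\,T_{\nu,j,l}(x,y,z),$$ $$T_{\nu,j,l}(x,y,z)=\frac{1}{2m(2m+1)^2}\sum_{n=0}^{2m}\sum_{k=0}^{n}(k+1)\sin((k+1)\theta_j)\,U_k(\cos\sigma_\nu(x,y))\,\widetilde T_{n-k}(z_l)\,\widetilde T_{n-k}(z).$$ For $m=0$ the sums are empty and $\mathcal{B}_0=0$. *)

(* Defs.v *)
From HB Require Import structures.
From mathcomp Require Import all_boot all_order all_algebra.
From mathcomp Require Import all_classical all_reals all_analysis.
From mathcomp Require Import ring.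

Set Implicit Arguments.
Unset Strict Implicit.
Unset Printing Implicit Defensive.

Import Order.TTheory GRing.Theory Num.Theory.
Import numFieldNormedType.Exports.

Local Open Scope classical_set_scope.
Local Open Scope ring_scope.

Definition disk (R : realType) : set (R * R) :=
  [set q | q.1 ^+ 2 + q.2 ^+ 2 <= 1].

Definition cylinder (R : realType) : set (R * R * R) :=
  [set p | disk p.1 /\ -1 <= p.2 <= 1].
Arguments cylinder R : clear implicits.

(* The parametrization of the chord has unit speed, so integration in [s]
   is integration with respect to arc length. *)
Definition radon (R : realType) (theta : R) (g : R * R -> R) (t : R) : R :=
  \int[lebesgue_measure]_(s in `[- Num.sqrt (1 - t ^+ 2),
                                 Num.sqrt (1 - t ^+ 2)])
    g (t * cos theta + s * sin theta, t * sin theta - s * cos theta).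

(* Chebyshev polynomials, by the three-term recurrence; the trigonometric
   identities that characterize them are [chebU_cos] and [chebTt_cos]. *)
Fixpoint chebT (R : nzRingType) (k : nat) {struct k} : {poly R} :=
  match k with
  | 0 => 1
  | 1 => 'X
  | (k'.+1 as k1).+1 => 'X * chebT R k1 *+ 2 - chebT R k'
  end.

Fixpoint chebU (R : nzRingType) (k : nat) {struct k} : {poly R} :=
  match k with
  | 0 => 1
  | 1 => 'X *+ 2
  | (k'.+1 as k1).+1 => 'X * chebU R k1 *+ 2 - chebU R k'
  end.

Definition chebTt (R : realType) (k : nat) : {poly R} :=
  if k is 0 then 1 else Num.sqrt 2 *: chebT R k.

Section ChebyshevTrig.
Context {R : realType}.
Implicit Types a : R.

Let two_steps (P : nat -> Prop) :
  P 0 -> P 1 -> (forall k, P k -> P k.+1 -> P k.+2) -> forall k, P k.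
Proof.
move=> P0 P1 PS k; suff: P k /\ P k.+1 by case.
by elim: k => [//|k [Pk Pk1]]; split=> //; exact: PS.
Qed.

Lemma chebU_cos k a : (chebU R k).[cos a] * sin a = sin (k.+1%:R * a).
Proof.
elim/two_steps: k => [||k IHk IHk1].
- by rewrite /= hornerC !mul1r.
- by rewrite /= !hornerE mulr_natl mulr2n sinD; ring.
- rewrite [chebU R k.+2]/= !hornerE mulrBl IHk.
  have -> : (cos a * (chebU R k.+1).[cos a] *+ 2) * sin a
     = cos a * ((chebU R k.+1).[cos a] * sin a) *+ 2 by ring.
  rewrite IHk1.
  have -> : k.+3%:R * a = k.+2%:R * a + a by rewrite -[k.+3]addn1 natrD; ring.
  have -> : k.+1%:R * a = k.+2%:R * a - a by rewrite -[k.+2]addn1 natrD; ring.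
  by rewrite sinB sinD; ring.
Qed.

Lemma chebT_cos k a : (chebT R k).[cos a] = cos (k%:R * a).
Proof.
elim/two_steps: k => [||k IHk IHk1].
- by rewrite /= hornerC mul0r cos0.
- by rewrite /= hornerX mul1r.
- rewrite [chebT R k.+2]/= !hornerE IHk IHk1.
  have -> : k.+2%:R * a = k.+1%:R * a + a by rewrite -[k.+2]addn1 natrD; ring.
  have -> : k%:R * a = k.+1%:R * a - a by rewrite -[k.+1]addn1 natrD; ring.
  by rewrite cosB cosD; ring.
Qed.

Lemma chebTt_cos k a :
  (chebTt R k).[cos a] = if k is 0 then 1 else Num.sqrt 2 * cos (k%:R * a).
Proof. by case: k => [|k]; rewrite /chebTt ?hornerC ?hornerZ ?chebT_cos. Qed.

End ChebyshevTrig.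

Section Algorithm.
Context {R : realType}.
Variable m : nat.

Definition theta (j : nat) : R := j%:R * pi / (2 * m + 1)%:R.

Definition gamma (l : nat) : R := (2 * l + 1)%:R / (4 * m)%:R * pi.

Definition znode (l : nat) : R := cos (gamma l).

Definition phi (nu : nat) : R := 2 * pi * nu%:R / (2 * m + 1)%:R.

Definition sigma (nu : nat) (q : R * R) : R :=
  acos (q.1 * cos (phi nu) + q.2 * sin (phi nu)).

Definition kernelT (nu j l : nat) (p : R * R * R) : R :=
  1 / (2 * m * (2 * m + 1) ^ 2)%:R *
  \sum_(0 <= n < 2 * m + 1) \sum_(0 <= k < n + 1)
    (k + 1)%:R * sin ((k + 1)%:R * theta j) *
    (chebU R k).[cos (sigma nu p.1)] *
    (chebTt R (n - k)).[znode l] * (chebTt R (n - k)).[p.2].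

Definition calB (f : R * R * R -> R) (p : R * R * R) : R :=
  \sum_(0 <= nu < 2 * m + 1) \sum_(1 <= j < 2 * m + 1) \sum_(0 <= l < 2 * m)
    radon (phi nu) (fun q => f (q, znode l)) (cos (theta j)) *
    kernelT nu j l p.

End Algorithm.

Definition unif_norm (R : realType) (K : set (R * R * R))
    (f : R * R * R -> R) : \bar R :=
  ereal_sup [set `|f p|%:E | p in K].

(* Elements of C(K) are represented by total functions that are continuous on
   K for the subspace topology; values outside K do not enter the norm. *)
Definition op_norm (R : realType) (K : set (R * R * R))
    (L : (R * R * R -> R) -> R * R * R -> R) : \bar R :=
  ereal_sup [set unif_norm K (L f) | f in
    [set f | {within K, continuous f} /\ (unif_norm K f <= 1%:E)%E]].

(* Main.v *)
Require Import Defs.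
From mathcomp Require Import all_boot all_order all_algebra.
From mathcomp Require Import all_classical all_reals all_analysis.
From mathcomp Require Import ring lra zify.

(**
The functional [f |-> R_phi(f(., ., z_l); cos theta_j)] has norm
[2 sin theta_j], and the [2m (2m + 1)] chords are pairwise distinct because
[N = 2m + 1] is odd.  A continuous function of norm 1 can therefore take
prescribed signs on all chords up to a small error, so that the norm is the
supremum over the cylinder of the Lebesgue function
[sum 2 sin theta_j |T_(nu,j,l)|].

Up to the factor [1 / (2m N^2)], with [z = cos zeta], the kernel [T_(nu,j,l)] is
half the sum over the two signs of
[sum_(1 <= k <= N) k sin(k theta_j) (sin(k sigma_nu) / sin sigma_nu)
D_(N-k)(gamma_l +- zeta)], where [D_p] is a Dirichlet kernel.

Upper bound.  Trigonometric sums of length at most [n] and frequency [x] are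
[O(e(x))] with [e(x) = n / (1 + n |sin x|)], and the sum of [e] over [n]
equispaced nodes is [O(n log n)].  One has
[sum_k k cos(k a) D_(N-k)(b) = O(n e(b) (e(a) + e(a + b) + e(a - b)))]; summing
over [j] and [l] gives two logarithms.  The factor [1 / sin sigma_nu], which
would cost a third one, is removed by a summation by parts against
[sin theta_j].

Lower bound.  At the point [((1, 0), 1)] the angle [sigma_nu] is [phi_nu], so
that [N (theta_j - phi_nu)] and [N (theta_j + phi_nu)] are multiples of [pi] and
the leading term of the kernel does not oscillate.  Writing
[x = theta_j - phi_nu - gamma_l], it is of size [N / (gamma_l x)] for
[1 / N << x <= gamma_l << 1], and summing [1 / (gamma_l x)] over the
nodes in this region gives the squared logarithm.  For the remaining
finitely many [m], the value of the operator at the constant function [1] shows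
that the Lebesgue function is at least 1.
*)

Set Implicit Arguments.
Unset Strict Implicit.
Unset Printing Implicit Defensive.

Import Order.TTheory GRing.Theory Num.Theory.
Import numFieldNormedType.Exports.

Local Open Scope classical_set_scope.
Local Open Scope ring_scope.

(** * Trigonometric sums over windows *)

Section TrigSums.
Context {R : realType}.
Implicit Types (x y t A B E : R) (v w c : nat -> R).

Lemma sin_natDpi k x : sin (x + k%:R * pi) = (-1) ^+ k * sin x.
Proof.
elim: k => [|k IHk]; first by rewrite mul0r addr0 expr0 mul1r.
have -> : x + k.+1%:R * pi = x + k%:R * pi + pi by rewrite -natr1; ring.
by rewrite sinDpi IHk exprS; ring.
Qed.

Lemma cos_natDpi k x : cos (x + k%:R * pi) = (-1) ^+ k * cos x.
Proof.
elim: k => [|k IHk]; first by rewrite mul0r addr0 expr0 mul1r.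
have -> : x + k.+1%:R * pi = x + k%:R * pi + pi by rewrite -natr1; ring.
by rewrite cosDpi IHk exprS; ring.
Qed.

Lemma mul_cos x y : cos x * cos y = (cos (x + y) + cos (x - y)) / 2.
Proof. by rewrite (cosD x y) (cosB x y); lra. Qed.

Lemma mul_sin x y : sin x * sin y = (cos (x - y) - cos (x + y)) / 2.
Proof. by rewrite (cosD x y) (cosB x y); lra. Qed.

Lemma mul_cos_sin x y : cos x * sin y = (sin (x + y) - sin (x - y)) / 2.
Proof. by rewrite (sinD x y) (sinB x y); lra. Qed.

Lemma norm_sin_le_half x : `|sin x| <= 2 * `|sin (x / 2)|.
Proof.
set h := x / 2; have -> : x = h *+ 2 by rewrite -mulr_natr /h; lra.
rewrite sin_mulr2n -mulr_natl normrM ger0_norm// ler_pM2l// normrM.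
by rewrite ler_piMl// cos_max.
Qed.


(** The multiplier [2 * sin x], instead of the usual [2 * sin (x / 2)], makes the telescoping of
    step two and the resulting bounds [pi]-periodic. *)
Lemma sum_cos_telescope (a b : nat) x t : (a <= b)%N ->
  2 * sin x * \sum_(a <= k < b) cos (k%:R * x + t) =
  sin (b%:R * x + t) + sin (b%:R * x + t - x)
  - (sin (a%:R * x + t) + sin (a%:R * x + t - x)).
Proof.
move=> ab; rewrite big_distrr /=.
rewrite (@telescope_sumr_eq _ _ _
  (fun k => sin (k%:R * x + t) + sin (k%:R * x + t - x))) // => k _.
have -> : k.+1%:R * x + t = k%:R * x + t + x by rewrite -natr1; ring.
by rewrite addrK (sinD _ x) (sinB _ x); ring.
Qed.

(* A smooth substitute for [min n (1 / |sin x|)], to which it is equivalent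
   up to a factor 2; it needs no case distinction at the zeros of [sin]. *)
Definition ek (n : nat) x : R := n%:R / (1 + n%:R * `|sin x|).

Lemma ek_den_gt0 n x : 0 < 1 + n%:R * `|sin x|.
Proof. by rewrite ltr_pwDl// mulr_ge0. Qed.

Lemma ek_ge0 n x : 0 <= ek n x.
Proof. by rewrite divr_ge0// ltW// ek_den_gt0. Qed.

Lemma ek_ge_half n x : (0 < n)%N -> 1 / 2 <= ek n x.
Proof.
move=> n0; rewrite /ek ler_pdivlMr ?ek_den_gt0//.
have n1 : (1 : R) <= n%:R by rewrite ler1n.
have := sin_max x; have := normr_ge0 (sin x).
move: (`|sin x|) (n%:R) n1 => s r *; nra.
Qed.

(** The basic [ek] estimates come from here: a trivial bound of size [n] is combined with a bound
    obtained after multiplication by [sin x]. *)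
Lemma ek_bound n x A B S : (0 < n)%N -> S <= n%:R * A -> `|sin x| * S <= B ->
  S <= (A + B) * ek n x.
Proof.
move=> n0 SA SB; rewrite /ek mulrA ler_pdivlMr ?ek_den_gt0//.
have n1 : (0 : R) <= n%:R by [].
rewrite mulrDr mulr1 (mulrC S) -mulrA mulrDl (mulrC A) lerD//.
by rewrite mulrC ler_wpM2r.
Qed.

Lemma ek_le_n n x : ek n x <= n%:R.
Proof. by rewrite /ek ler_pdivrMr ?ek_den_gt0// ler_peMr// lerDl mulr_ge0. Qed.

Lemma ek_addpi n x : ek n (x + pi) = ek n x.
Proof. by rewrite /ek sinDpi normrN. Qed.

Lemma ek_le n p x : (0 < p)%N -> (n <= 3 * p)%N -> ek n x <= 3 * ek p x.
Proof.
move=> p0 np; rewrite /ek mulrA ler_pdivrMr ?ek_den_gt0// mulrAC.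
rewrite ler_pdivlMr ?ek_den_gt0//.
have : n%:R <= 3 * p%:R :> R by rewrite -natrM ler_nat.
have : 0 <= n%:R * p%:R * `|sin x| by rewrite !mulr_ge0.
by move: (`|sin x|) (n%:R) (p%:R) => s r q; lra.
Qed.

(** Windows rather than initial sums: such bounds survive summation by parts and the interchange of
    a triangular double sum. *)
Definition wbound (n : nat) v E :=
  forall a b : nat, (a <= b)%N -> (b <= n)%N ->
    `|\sum_(a <= k < b) v k| <= E.

Lemma wbound_ge0 n v E : wbound n v E -> 0 <= E.
Proof. by move=> /(_ 0 0 isT isT); exact: le_trans. Qed.

Lemma wbound_le n v E E' : E <= E' -> wbound n v E -> wbound n v E'.
Proof. by move=> EE' vE a b ab bn; rewrite (le_trans _ EE')// vE. Qed.

Lemma eq_wbound n v w E : (forall k, (k < n)%N -> v k = w k) ->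
  wbound n v E -> wbound n w E.
Proof.
move=> vw vE a b ab bn; rewrite (_ : \sum_(_ <= _ < _) _ =
  \sum_(a <= k < b) v k) ?vE//.
apply: eq_big_nat => k /andP[_ kb]; rewrite vw//; exact: leq_trans bn.
Qed.

Lemma wboundD n v w E F : wbound n v E -> wbound n w F ->
  wbound n (fun k => v k + w k) (E + F).
Proof.
move=> vE wF a b ab bn; rewrite big_split/= (le_trans (ler_normD _ _))//.
by rewrite lerD ?vE ?wF.
Qed.

Lemma wboundZ n v A E : wbound n v E -> wbound n (fun k => A * v k) (`|A| * E).
Proof.
by move=> vE a b ab bn; rewrite -big_distrr/= normrM ler_wpM2l ?vE.
Qed.

Lemma wbound_cos n x t : (0 < n)%N ->
  wbound n (fun k => cos (k%:R * x + t)) (3 * ek n x).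
Proof.
move=> n0 a b ab bn.
have -> : 3 = 1 + 2 :> R by ring.
apply: ek_bound => //.
  rewrite (le_trans (ler_norm_sum _ _ _))//.
  rewrite (@le_trans _ _ (\sum_(a <= k < b) 1))//.
    by apply: ler_sum => k _; exact: cos_max.
  rewrite big_const_nat iter_addr addr0 mulr1 ler_nat.
  by rewrite (leq_trans (leq_subr _ _)).
rewrite -(@ler_pM2l _ 2)// mulrA -[X in X * _ * _]ger0_norm// -!normrM.
rewrite sum_cos_telescope// (le_trans (ler_normB _ _))//.
have h y z : `|sin y + sin z| <= 2.
  by rewrite (le_trans (ler_normD _ _))// lerD// sin_max.
by have := h (b%:R * x + t) (b%:R * x + t - x);
   have := h (a%:R * x + t) (a%:R * x + t - x); lra.
Qed.

(** The product formula moves the phase to [t + u] and [t - u], so the hypotheses have to be uniform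
    in the phase. *)
Lemma wbound_cosM n v x y t u E F :
  (forall t, wbound n (fun k => cos (k%:R * (x + y) + t) * v k) E) ->
  (forall t, wbound n (fun k => cos (k%:R * (x - y) + t) * v k) F) ->
  wbound n (fun k => cos (k%:R * x + t) * (cos (k%:R * y + u) * v k))
    ((E + F) / 2).
Proof.
move=> vE vF.
have h1 := wboundZ (2^-1) (vE (t + u)); have h2 := wboundZ (2^-1) (vF (t - u)).
apply: eq_wbound (wbound_le _ (wboundD h1 h2)) => [k _ /=|].
  rewrite [RHS]mulrA mul_cos.
  set A := k%:R * (x + y) + _; set B := k%:R * (x - y) + _.
  have -> : k%:R * x + t + (k%:R * y + u) = A by rewrite /A; ring.
  have -> : k%:R * x + t - (k%:R * y + u) = B by rewrite /B; ring.
  by ring.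
by rewrite ger0_norm ?invr_ge0//; lra.
Qed.

Lemma wbound_cos_cos n x y t u : (0 < n)%N ->
  wbound n (fun k => cos (k%:R * x + t) * cos (k%:R * y + u))
    (3 / 2 * (ek n (x + y) + ek n (x - y))).
Proof.
move=> n0.
have h z s : wbound n (fun k => cos (k%:R * z + s) * 1) (3 * ek n z).
  by apply: eq_wbound (wbound_cos z s n0) => k _; rewrite mulr1.
apply: eq_wbound (wbound_le _ (wbound_cosM t u (h (x + y)) (h (x - y)))).
  by move=> k _; rewrite mulr1.
lra.
Qed.

(** Summation by parts; the boundary term and the increments contribute [A * n * E] each. The
    weights will be [2 * k] and [dirichlet (N - k) b]. *)
Lemma wbound_lipschitz n c A v E :
  (forall k, (k <= n)%N -> `|c k| <= A * n%:R) ->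
  (forall k, (k < n)%N -> `|c k.+1 - c k| <= A) ->
  wbound n v E -> wbound n (fun k => c k * v k) (2 * A * n%:R * E).
Proof.
move=> cb cl vE a b ab bn.
have E0 := wbound_ge0 vE.
have A0 : (0 < n)%N -> 0 <= A by move=> n0; exact: le_trans (cl 0%N n0).
pose V d := \sum_(a <= k < d) v k.
have -> : \sum_(a <= k < b) c k * v k =
    c b * V b - \sum_(a <= k < b) (c k.+1 - c k) * V k.+1.
  elim: b ab {bn} => [|b IHb].
    by rewrite leqn0 => /eqP ->; rewrite /V !big_geq//; ring.
  rewrite leq_eqVlt => /predU1P[<-|ab]; first by rewrite /V !big_geq//; ring.
  rewrite big_nat_recr// [in RHS]big_nat_recr//= IHb//.
  have -> : V b.+1 = V b + v b by rewrite /V big_nat_recr.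
  by ring.
have -> : 2 * A * n%:R * E = A * n%:R * E + A * n%:R * E by ring.
rewrite (le_trans (ler_normB _ _))// lerD//.
  by rewrite normrM ler_pM// ?cb// vE.
rewrite (le_trans (ler_norm_sum _ _ _))//.
rewrite (@le_trans _ _ (\sum_(a <= k < b) A * E))//.
  rewrite big_nat_cond [leRHS]big_nat_cond ler_sum// => k /andP[/andP[ak kb] _].
  have kn : (k < n)%N by apply: leq_trans bn.
  by rewrite normrM ler_pM// ?cl// vE// leqW.
rewrite big_const_nat iter_addr addr0 -[leLHS]mulr_natr mulrAC.
case: n bn A0 {cb cl vE} => [|n] bn A0.
  by move: bn; rewrite leqn0 => /eqP ->; rewrite !mulr0 mul0r.
rewrite ler_wpM2r// ler_wpM2l// ?A0// ler_nat.
exact: leq_trans (leq_subr _ _) bn.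
Qed.

End TrigSums.

(** * The kernel *)

(* [cheb_s s k] is [sin (k s) / sin s], extended by continuity. *)
Definition cheb_s (R : realType) (s : R) (k : nat) : R :=
  if k is k'.+1 then (chebU R k').[cos s] else 0.
Arguments cheb_s {R} s k : simpl never.

Section Kernel.
Context {R : realType}.
Implicit Types (x y t u A B E F s th b : R) (v w c : nat -> R).

Lemma exchange_triangle (F : nat -> nat -> R) d :
  \sum_(0 <= k < d) \sum_(0 <= r < k) F k r =
  \sum_(0 <= r < d) \sum_(r.+1 <= k < d) F k r.
Proof.
elim: d => [|d IHd]; first by rewrite !big_geq.
rewrite big_nat_recr//= IHd [in RHS]big_nat_recr//=.
rewrite (big_geq (leqnn d.+1)) addr0.
rewrite -big_split/=; apply: eq_big_nat => r /andP[_ rd].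
by rewrite [in RHS]big_nat_recr.
Qed.

Lemma cheb_s_sin s k : cheb_s s k * sin s = sin (k%:R * s).
Proof. by case: k => [|k]; rewrite ?mul0r ?sin0// -chebU_cos. Qed.

Lemma cheb_s0 s : cheb_s s 0 = 0.
Proof. by []. Qed.

Lemma cheb_s1 s : cheb_s s 1 = 1.
Proof. by rewrite /cheb_s hornerC. Qed.

Lemma cheb_sSS s k : cheb_s s k.+2 = 2 * cos s * cheb_s s k.+1 - cheb_s s k.
Proof.
by case: k => [|k]; rewrite /cheb_s /= !hornerE; ring.
Qed.

Lemma nat_ind2 (P : nat -> Prop) :
  P 0 -> P 1 -> (forall k, P k -> P k.+1 -> P k.+2) -> forall k, P k.
Proof.
move=> P0 P1 PS k; suff: P k /\ P k.+1 by case.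
by elim: k => [//|k [Pk Pk1]]; split=> //; exact: PS.
Qed.

Lemma cheb_s_step s k : cheb_s s k.+2 = cheb_s s k + 2 * cos (k.+1%:R * s).
Proof.
elim/nat_ind2: k => [||k IH0 IH1].
- by rewrite cheb_sSS mul1r cheb_s1 cheb_s0; ring.
- rewrite cheb_sSS (cheb_sSS _ 0) (_ : 2 * s = s *+ 2) ?mulr_natl//.
  by rewrite cos_mulr2n cheb_s1 cheb_s0; ring.
- have := cheb_sSS s k; rewrite (cheb_sSS s k.+2) IH1 IH0.
  have -> : k.+3%:R * s = k.+2%:R * s + s by rewrite -[k.+3]addn1 natrD; ring.
  have -> : k.+1%:R * s = k.+2%:R * s - s by rewrite -[k.+2]addn1 natrD; ring.
  by rewrite (cosD _ s) (cosB _ s); lra.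
Qed.

(** [sin (k s) / sin s] is a sum of [k] exponentials with frequencies [k - 1, k - 3, ..., 1 - k];
    written with cosines, no division by [sin s] remains. *)
Lemma cheb_s_sum s k :
  cheb_s s k = \sum_(0 <= r < k) cos (k%:R * s - (1 + 2 * r%:R) * s).
Proof.
elim/nat_ind2: k => [||k IH0 _].
- by rewrite big_geq.
- by rewrite big_nat1 mulr0 addr0 subrr cos0 cheb_s1.
rewrite cheb_s_step IH0 [in RHS]big_nat_recl// [in RHS]big_nat_recr//=.
rewrite [in RHS](eq_big_nat _ _
  (F2 := fun r => cos (k%:R * s - (1 + 2 * r%:R) * s))).
  rewrite -[cos (_ - (1 + 2 * k.+1%:R) * s)]cosN.
  set a := cos (k.+2%:R * s - _); set c := cos (- _).
  have -> : a = cos (k.+1%:R * s).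
    by congr cos; rewrite -!(addn1 k.+1) natrD; ring.
  have -> : c = cos (k.+1%:R * s).
    by congr cos; rewrite -!(addn1 k.+1) -(addn1 k) !natrD; ring.
  by ring.
move=> r _; congr cos.
by rewrite -!(addn1 k.+1) -(addn1 k) -(addn1 r) !natrD; ring.
Qed.

Lemma norm_cheb_s_le s k : `|cheb_s s k| <= k%:R.
Proof.
rewrite cheb_s_sum (le_trans (ler_norm_sum _ _ _))//.
rewrite (@le_trans _ _ (\sum_(0 <= r < k) 1))//.
  by apply: ler_sum => r _; exact: cos_max.
by rewrite big_const_nat iter_addr addr0 subn0.
Qed.

Lemma norm_cheb_s_ek s k n : (k <= n)%N -> (0 < n)%N ->
  `|cheb_s s k| <= 2 * ek n s.
Proof.
move=> kn n0; have -> : 2 = 1 + 1 :> R by ring.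
apply: ek_bound => //.
  by rewrite mulr1 (le_trans (norm_cheb_s_le _ _))// ler_nat.
by rewrite -normrM mulrC cheb_s_sin sin_max.
Qed.

(** Two bounds on initial sums feed [ek_bound]: by [cheb_s_sum] they split into at most [n] windows,
    each at most [E]; multiplied by [sin s] they become a single window. *)
Lemma wbound_cheb_s n v s E : (0 < n)%N ->
  (forall t, wbound n (fun k => cos (k%:R * s + t) * v k) E) ->
  wbound n (fun k => cheb_s s k * v k) (4 * ek n s * E).
Proof.
move=> n0 vE; have E0 := wbound_ge0 (vE 0).
have h d : (d <= n)%N ->
  `|\sum_(0 <= k < d) cheb_s s k * v k| <= (E + E) * ek n s.
  move=> dn; apply: ek_bound => //.
    under eq_bigr do rewrite cheb_s_sum big_distrl/=.
    rewrite exchange_triangle (le_trans (ler_norm_sum _ _ _))//.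
    rewrite (@le_trans _ _ (\sum_(0 <= r < d) E))//.
      rewrite big_nat_cond [leRHS]big_nat_cond.
      rewrite ler_sum// => r /andP[/andP[_ rd] _].
      exact: vE.
    by rewrite big_const_nat iter_addr addr0 subn0 -[leLHS]mulr_natl
      ler_wpM2r// ler_nat.
  rewrite -normrM big_distrr/=.
  (* The phase [- pi / 2] turns the cosine into [sin (k s)], which is [cheb_s s k * sin s]. *)
  have := vE (- (pi / 2)) 0%N d isT dn.
  congr (`|_| <= _); apply: eq_bigr => k _.
  by rewrite cosBpihalf -cheb_s_sin; ring.
move=> a b ab bn.
have -> : \sum_(a <= k < b) cheb_s s k * v k =
   \sum_(0 <= k < b) cheb_s s k * v k - \sum_(0 <= k < a) cheb_s s k * v k.
  by rewrite (big_cat_nat (n := a) (m := 0) (p := b))//= addrAC subrr add0r.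
rewrite (le_trans (ler_normB _ _))//.
have -> : 4 * ek n s * E = (E + E) * ek n s + (E + E) * ek n s by ring.
by rewrite lerD// h// (leq_trans ab).
Qed.

Definition dirichlet (p : nat) b : R :=
  1 + \sum_(1 <= i < p.+1) 2 * cos (i%:R * b).

Lemma dirichlet0 b : dirichlet 0 b = 1.
Proof. by rewrite /dirichlet big_geq ?addr0. Qed.

Lemma dirichletS p b : dirichlet p.+1 b = dirichlet p b + 2 * cos (p.+1%:R * b).
Proof. by rewrite /dirichlet big_nat_recr//= addrA. Qed.

Lemma sin_half_dirichlet p b :
  sin (b / 2) * dirichlet p b = sin (p%:R * b + b / 2).
Proof.
elim: p => [|p IHp]; first by rewrite dirichlet0 mulr1 mul0r add0r.
rewrite dirichletS mulrDr IHp.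
have -> : p%:R * b + b / 2 = p.+1%:R * b - b / 2 by rewrite -(natr1 p); lra.
by rewrite (sinB _ (b / 2)) (sinD _ (b / 2)); ring.
Qed.

Lemma norm_dirichlet_le p b : `|dirichlet p b| <= 1 + 2 * p%:R.
Proof.
elim: p => [|p IHp]; first by rewrite dirichlet0 normr1 mulr0 addr0.
rewrite dirichletS (le_trans (ler_normD _ _))// normrM (ger0_norm (ler0n _ 2)).
by have := cos_max (p.+1%:R * b); rewrite -(natr1 p); lra.
Qed.

(* The phases [0, b, -b] of the frequency [a] are those met when the factor
   [dirichlet] is either summed trivially or replaced by its closed form. *)
Definition ek3 n a b : R := ek n a + ek n (a + b) + ek n (a - b).

(** Here [ek_bound] is applied in the variable [b]. The trivial branch treats [dirichlet (N - k) b]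
    as a slowly varying weight; the other one uses its closed form and leaves cosines of frequencies
    [a + b] and [a - b]. *)
Lemma wbound_cos_dirichlet N a b t :
  wbound N.+1 (fun k => cos (k%:R * a + t) * dirichlet (N - k) b)
    (12 * ek N.+1 b * ek3 N.+1 a b).
Proof.
move=> d e de eN; set S := \sum_(_ <= _ < _) _.
apply: (@le_trans _ _
  ((12 * ek N.+1 a + 3 * (ek N.+1 (a + b) + ek N.+1 (a - b))) * ek N.+1 b));
  last first.
  rewrite [leRHS]mulrAC ler_wpM2r ?ek_ge0// /ek3.
  have := ek_ge0 N.+1 (a + b); have := ek_ge0 N.+1 (a - b); lra.
apply: ek_bound => //.
  have -> : N.+1%:R * (12 * ek N.+1 a) = 2 * 2 * N.+1%:R * (3 * ek N.+1 a).
    by ring.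
  rewrite /S; under eq_bigr do rewrite mulrC.
  apply: (wbound_lipschitz (n := N.+1)) => //; last exact: wbound_cos.
    move=> k _; rewrite (le_trans (norm_dirichlet_le _ _))//.
    have : (N - k)%:R <= N%:R :> R by rewrite ler_nat leq_subr.
    by rewrite -(natr1 N); lra.
  move=> k; rewrite ltnS leq_eqVlt => /predU1P[->|kN].
    (* At [k = N] truncated subtraction makes both terms [dirichlet 0 b], so the increment is
       zero. *)
    by rewrite subnn (_ : N - N.+1 = 0)%N ?subrr ?normr0//; lia.
  have -> : (N - k = (N - k.+1).+1)%N by lia.
  rewrite dirichletS opprD addNKr normrN normrM ger0_norm//.
  by have := cos_max ((N - k.+1).+1%:R * b); lra.
apply: (@le_trans _ _ (2 * `|sin (b / 2) * S|)).
  by rewrite normrM mulrA ler_wpM2r// norm_sin_le_half.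
rewrite -(_ : 2 * (3 / 2 * (ek N.+1 (a + b) + ek N.+1 (a - b))) =
  3 * (ek N.+1 (a + b) + ek N.+1 (a - b))); last by lra.
rewrite ler_pM2l//.
have := wbound_cos_cos a (- b) t (N%:R * b + b / 2 - pi / 2) (ltn0Sn N).
rewrite opprK => /(_ d e de eN); rewrite [ek _ (a - b) + _]addrC.
congr (`|_| <= _); rewrite /S big_distrr/=; apply: eq_big_nat => k /andP[_ ke].
rewrite mulrCA sin_half_dirichlet natrB; last by lia.
have -> : k%:R * - b + (N%:R * b + b / 2 - pi / 2) =
  (N%:R - k%:R) * b + b / 2 - pi / 2 by ring.
by rewrite cosBpihalf.
Qed.

(** The bracket is [2 * sin th * sin (k.+1 * th)], so a factor [sin th] permits summation by parts
    with step two, the step of [cheb_s_step]. Since [h 0 = 0], the coefficient [h 2] of [cos th] can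
    be read as [h 2 - h 0]. *)
Lemma sum_by_parts_cos h th P : h 0 = 0 ->
  \sum_(0 <= k < P.+1) h k.+1 * (cos (k%:R * th) - cos (k.+2%:R * th)) =
  h 1 + \sum_(0 <= k < P) (h k.+2 - h k) * cos (k.+1%:R * th)
  - h P * cos (P.+1%:R * th) - h P.+1 * cos (P.+2%:R * th) :> R.
Proof.
move=> h0; elim: P => [|P IHP].
  by rewrite big_nat1 big_geq// mul0r cos0 h0; ring.
by rewrite big_nat_recr//= IHP [in RHS]big_nat_recr//=; ring.
Qed.

End Kernel.

(** * Pointwise bound for the kernel *)

Section KernelBound.
Context {R : realType}.
Implicit Types (x y t u A B E F s th b : R) (v w c : nat -> R).

Definition ek4 n th s b : R :=
  ek n (th + s + b) + ek n (th + s - b) +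
  (ek n (th - s + b) + ek n (th - s - b)).

Lemma wbound_cheb_s_cos_cos n th s b t u : (0 < n)%N ->
  wbound n (fun k => cheb_s s k *
      (2 * k%:R * (cos (k%:R * th + t) * cos (k%:R * b + u))))
    (12 * n%:R * ek n s * ek4 n th s b).
Proof.
move=> n0.
have -> : 12 * n%:R * ek n s * ek4 n th s b =
  4 * ek n s * (2 * 2 * n%:R * (3 / 4 * ek4 n th s b)) by lra.
apply: wbound_cheb_s => // w.
have h := wbound_cosM t w (fun a => wbound_cos_cos (th + s) b a u n0)
                          (fun a => wbound_cos_cos (th - s) b a u n0).
apply: eq_wbound (wbound_lipschitz (c := fun k => 2 * k%:R) (A := 2) _ _
  (wbound_le _ h)).
- by move=> k _; ring.
- by move=> k kn; rewrite ger0_norm ?mulr_ge0// ler_pM2l// ler_nat.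
- by move=> k _; rewrite -(natr1 k) mulrDr addrAC subrr add0r mulr1 ger0_norm.
- by rewrite /ek4; lra.
Qed.

Lemma wbound_cos_cos_dirichlet N th s b t u :
  wbound N.+1 (fun k => cos (k%:R * th + t) *
      (cos (k%:R * s + u) * dirichlet (N - k) b))
    (6 * ek N.+1 b * (ek3 N.+1 (th + s) b + ek3 N.+1 (th - s) b)).
Proof.
have h := wbound_cosM (v := fun k => dirichlet (N - k) b) t u
  (fun a => @wbound_cos_dirichlet _ N (th + s) b a)
  (fun a => @wbound_cos_dirichlet _ N (th - s) b a).
by apply: wbound_le h; lra.
Qed.

Definition Qsum N th s b : R :=
  \sum_(0 <= k < N) k.+1%:R * sin (k.+1%:R * th) * cheb_s s k.+1
     * dirichlet (N - k.+1) b.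

(* Multiplying by [sin th] and summing by parts trades the factor
   [1 / sin s] hidden in [cheb_s] for terms that are either free of it or lack
   the singularity in [b]; this is what saves a logarithm. *)
Lemma sin_Qsum P th s b : let N := P.+1 in
  2 * (sin th * Qsum N th s b) =
  dirichlet P b
  + \sum_(1 <= k < N) 2 * k%:R *
      (cos (k%:R * th) * (cos (k%:R * s) * dirichlet (N - k) b))
  + 2 * cos s * \sum_(1 <= k < N)
      cheb_s s k * (cos (k%:R * th) * dirichlet (N - k) b)
  - \sum_(2 <= k < N.+1) cheb_s s k *
      (2 * k%:R * (cos (k%:R * th - th) * cos (k%:R * b - N.+1%:R * b)))
  - \sum_(0 <= k < P) cheb_s s k *
      (2 * k%:R * (cos (k%:R * th + th) * cos (k%:R * b - N%:R * b)))
  - P%:R * cheb_s s P * dirichlet 1 b * cos (N%:R * th)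
  - N%:R * cheb_s s N * cos (N.+1%:R * th).
Proof.
move=> N.
pose h k := k%:R * cheb_s s k * dirichlet (N - k) b.
have -> : 2 * (sin th * Qsum N th s b) =
  \sum_(0 <= k < N) h k.+1 * (cos (k%:R * th) - cos (k.+2%:R * th)).
  rewrite /Qsum !big_distrr/=; apply: eq_bigr => k _.
  have -> : cos (k%:R * th) = cos (k.+1%:R * th - th).
    by congr cos; rewrite -(natr1 k); ring.
  have -> : cos (k.+2%:R * th) = cos (k.+1%:R * th + th).
    by congr cos; rewrite -(natr1 k.+1); ring.
  by rewrite (cosD _ th) (cosB _ th) /h; ring.
rewrite sum_by_parts_cos; last by rewrite /h !mul0r.
have h1 : h 1 = dirichlet P b by rewrite /h cheb_s1 !mul1r subn1.
have hP : h P = P%:R * cheb_s s P * dirichlet 1 b.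
  by rewrite /h (_ : N - P = 1)%N// /N; lia.
have hN : h P.+1 = N%:R * cheb_s s N by rewrite /h subnn dirichlet0 mulr1.
rewrite h1 hP hN -!/N; congr (_ - _ - _); rewrite -!addrA; congr (_ + _).
rewrite !big_add1/= big_distrr/=.
(* Product rule for [h k.+2 - h k], with [c k] for [cheb_s s k]. In [(k+2) c(k+2) - k c(k) = (k+1)
   (c(k+2) - c(k)) + (c(k+2) + c(k))] the first bracket is [2 cos ((k+1) s)], free of [1 / sin s],
   and the second, [2 cos s c(k+1)], lacks the weight [k]. The increments of [dirichlet] give the
   two remaining sums. *)
rewrite -!sumrN -!big_split/=; apply: eq_big_nat => k /andP[_ kP].
have ck : dirichlet (N - k) b =
    dirichlet (N - k.+1) b + 2 * cos ((N - k)%:R * b).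
  by rewrite (_ : N - k = (N - k.+1).+1)%N ?dirichletS// /N; lia.
have cS : dirichlet (N - k.+1) b =
    dirichlet (N - k.+2) b + 2 * cos ((N - k.+1)%:R * b).
  by rewrite (_ : N - k.+1 = (N - k.+2).+1)%N ?dirichletS// /N; lia.
have Nk : cos (k%:R * b - N%:R * b) = cos ((N - k)%:R * b).
  by rewrite -cosN natrB; [congr cos; ring|rewrite /N; lia].
have Nk2 : cos (k.+2%:R * b - N.+1%:R * b) = cos ((N - k.+1)%:R * b).
  rewrite -cosN natrB; last by rewrite /N; lia.
  by congr cos; rewrite -(natr1 k.+1) -(natr1 N); ring.
have tk : cos (k%:R * th + th) = cos (k.+1%:R * th).
  by congr cos; rewrite -(natr1 k); ring.
have tk2 : cos (k.+2%:R * th - th) = cos (k.+1%:R * th).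
  by congr cos; rewrite -(natr1 k.+1); ring.
have s2 := cheb_s_step s k; have s1 := cheb_sSS s k.
rewrite Nk Nk2 tk tk2 /h ck cS.
set D := dirichlet (N - k.+2) b.
have -> : 2 * cos s * (cheb_s s k.+1 * (cos (k.+1%:R * th) *
   (D + 2 * cos ((N - k.+1)%:R * b)))) =
  (cheb_s s k.+2 + cheb_s s k) * (cos (k.+1%:R * th) *
   (D + 2 * cos ((N - k.+1)%:R * b))) by rewrite s1; ring.
rewrite s2 -(natr1 k.+1) -(natr1 k); ring.
Qed.

Lemma norm_Qsum_le P th s b :
  `|sin th * Qsum P.+1 th s b| <= 36 * P.+2%:R *
    (ek P.+2 b * (ek3 P.+2 (th + s) b + ek3 P.+2 (th - s) b) +
     ek P.+2 s * (ek4 P.+2 th s b + 1)).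
Proof.
rewrite -(@ler_pM2l _ 2)// -{1}[2]ger0_norm// -normrM sin_Qsum.
set N := P.+1; set n := N.+1.
set X1 := \sum_(1 <= k < N) _; set X2 := \sum_(1 <= k < N) _.
set X3 := \sum_(2 <= k < n) _; set X4 := \sum_(0 <= k < P) _.
set E := ek n b * _.
have n0 : (0 < n)%N by [].
have Nn : (N <= n)%N by [].
have b1 : `|X1| <= 24 * n%:R * E.
  have -> : 24 * n%:R * E = 2 * 2 * n%:R *
      (6 * ek n b * (ek3 n (th + s) b + ek3 n (th - s) b)) by rewrite /E; ring.
  have h := @wbound_cos_cos_dirichlet N th s b 0 0.
  have := wbound_lipschitz (c := fun k => 2 * k%:R) (A := 2) _ _ h
    (isT : 1 <= N)%N Nn.
  rewrite (_ : \sum_(_ <= _ < _) _ = X1).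
    apply => [k kn|k _].
      by rewrite ger0_norm ?mulr_ge0// ler_pM2l// ler_nat.
    by rewrite -(natr1 k) mulrDr addrAC subrr add0r mulr1 ger0_norm.
  by apply: eq_bigr => k _; rewrite !addr0.
have b2 : `|2 * cos s * X2| <= 48 * n%:R * E.
  have h t : wbound n (fun k => cos (k%:R * s + t) *
      (cos (k%:R * th) * dirichlet (N - k) b)) (6 * E).
    rewrite /E mulrA.
    apply: eq_wbound (@wbound_cos_cos_dirichlet N th s b 0 t) => k _.
    by rewrite addr0; ring.
  have E0 : 0 <= 6 * E := wbound_ge0 (h 0).
  have hX : `|X2| <= 4 * ek n s * (6 * E) :=
    wbound_cheb_s n0 h (isT : 1 <= N)%N Nn.
  (* There is no weight [k] in [X2], so its factor [ek n s] can afford the trivial bound [n]. *)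
  have hn : 4 * ek n s * (6 * E) <= 4 * n%:R * (6 * E).
    by rewrite ler_wpM2r// ler_pM2l// ek_le_n.
  rewrite normrM.
  have hc : `|2 * cos s| <= 2.
    by rewrite normrM ger0_norm// ler_piMr// cos_max.
  have -> : 48 * n%:R * E = 2 * (4 * n%:R * (6 * E)) by ring.
  by rewrite ler_pM// (le_trans hX hn).
have b3 : `|X3| <= 12 * n%:R * ek n s * ek4 n th s b.
  exact: (@wbound_cheb_s_cos_cos n th s b _ _ n0 2 n).
have b4 : `|X4| <= 12 * n%:R * ek n s * ek4 n th s b.
  exact: (@wbound_cheb_s_cos_cos n th s b _ _ n0 0 P _ (leqW (leqW (leqnn P)))).
(* The boundary terms are [O(n)] or [O(n * ek n s)]; as [ek n s] is at least [1 / 2], the summand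
   [1] next to [ek4] absorbs them. *)
have s2 := ek_ge_half s n0.
have Pn : P%:R = n%:R - 2 :> R by rewrite /n /N -(natr1 P.+1) -(natr1 P); ring.
have NN : N%:R = n%:R - 1 :> R by rewrite /n -(natr1 N); ring.
have P0 : 0 <= P%:R :> R by [].
have nR : 0 <= n%:R :> R by [].
have b5 : `|dirichlet P b| <= 4 * n%:R * ek n s.
  apply: (le_trans (norm_dirichlet_le _ _)); rewrite Pn.
  have : n%:R * (1 / 2) <= n%:R * ek n s by rewrite ler_wpM2l.
  by lra.
have b6 : `|P%:R * cheb_s s P * dirichlet 1 b * cos (N%:R * th)|
    <= 6 * n%:R * ek n s.
  have -> : 6 * n%:R * ek n s = n%:R * (2 * ek n s) * 3 * 1 by ring.
  rewrite !normrM normr_nat ler_pM ?mulr_ge0 ?cos_max// ler_pM ?mulr_ge0//.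
    rewrite ler_pM//; first by rewrite Pn; lra.
    by apply: norm_cheb_s_ek => //; rewrite leqW.
  by rewrite (le_trans (norm_dirichlet_le _ _))//; lra.
have b7 : `|N%:R * cheb_s s N * cos (n%:R * th)| <= 2 * n%:R * ek n s.
  have -> : 2 * n%:R * ek n s = n%:R * (2 * ek n s) * 1 by ring.
  rewrite !normrM normr_nat ler_pM ?mulr_ge0 ?cos_max//.
  by rewrite ler_pM ?norm_cheb_s_ek// NN; lra.
have b8 : 0 <= n%:R * ek n s * ek4 n th s b.
  by rewrite !mulr_ge0 ?ek_ge0// /ek4 !addr_ge0 ?ek_ge0.
have b9 : 0 <= n%:R * ek n s by rewrite mulr_ge0 ?ek_ge0.
have tri (x y z u v w q : R) :
    `|x + y + z - u - v - w - q| <=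
      `|x| + `|y| + `|z| + `|u| + `|v| + `|w| + `|q|.
  by do 4 rewrite (le_trans (ler_normB _ _))// lerD//;
     do 2 rewrite (le_trans (ler_normD _ _))// lerD//.
rewrite (le_trans (tri _ _ _ _ _ _ _))//.
move: b1 b2 b3 b4 b5 b6 b7 b8 b9; rewrite -/E.
move: (`|X1|) (`|_ * X2|) (`|X3|) (`|X4|) (`|dirichlet P b|)
  (`|P%:R * _ * _ * _|) (`|N%:R * _ * _|) => y1 y2 y3 y4 y5 y6 y7.
by lra.
Qed.

End KernelBound.

(** * Sums over the nodes *)

Section NodeSums.
Context {R : realType}.
Implicit Types (x y t : R).

Lemma sum_shift_periodic (g : R -> R) n y :
  (0 < n)%N -> (forall x, g (x + pi) = g x) ->
  \sum_(0 <= j < n) g (y + pi / n%:R + j%:R * (pi / n%:R)) =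
  \sum_(0 <= j < n) g (y + j%:R * (pi / n%:R)).
Proof.
case: n => // n _ gpi.
set h := pi / _.
have hpi : pi = n.+1%:R * h by rewrite mulrC divfK// pnatr_eq0.
rewrite big_nat_recr//= [RHS]big_nat_recl//= addrC mul0r addr0; congr (_ + _).
  by rewrite -[RHS]gpi hpi -(natr1 n); congr g; ring.
by apply: eq_bigr => j _; congr g; rewrite -(natr1 j); ring.
Qed.

Lemma sum_shift_periodic_int (g : R -> R) n (k : int) y :
  (0 < n)%N -> (forall x, g (x + pi) = g x) ->
  \sum_(0 <= j < n) g (y + k%:~R * (pi / n%:R) + j%:R * (pi / n%:R)) =
  \sum_(0 <= j < n) g (y + j%:R * (pi / n%:R)).
Proof.
move=> n0 gpi; set h := pi / n%:R.
have pos (i : nat) z : \sum_(0 <= j < n) g (z + i%:R * h + j%:R * h) =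
  \sum_(0 <= j < n) g (z + j%:R * h).
  elim: i => [|i IHi]; first by rewrite mul0r addr0.
  rewrite -[RHS]IHi -[RHS]sum_shift_periodic//; apply: eq_bigr => j _.
  by congr g; rewrite -(natr1 i) /h; ring.
case: k => k; first exact: pos.
rewrite -[LHS](pos k.+1); apply: eq_bigr => j _; congr g.
by rewrite NegzE; ring.
Qed.

Lemma harmonic_le_ln n : (0 < n)%N ->
  \sum_(1 <= j < n.+1) j%:R^-1 <= 1 + ln n%:R :> R.
Proof.
elim: n => // -[_ _|n IHn _]; first by rewrite big_nat1 invr1 ln1 addr0.
rewrite big_nat_recr//= (le_trans (lerD (IHn _) (lexx _)))// -addrA lerD2l.
have n1 : (0 : R) < n.+1%:R by []. have n2 : (0 : R) < n.+2%:R by [].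
rewrite -lerBrDl -ln_div ?posrE//.
have := @le_ln1Dx R (- n.+2%:R^-1).
have -> : 1 + - n.+2%:R^-1 = n.+1%:R / n.+2%:R :> R.
  by rewrite -[n.+1%:R](addrK 1) natr1 mulrBl divff ?mul1r ?pnatr_eq0.
rewrite ltrN2 invf_lt1// ltr1n => /(_ isT).
by rewrite -[n.+2%:R / _]invf_div lnV ?posrE ?divr_gt0// lerNr.
Qed.

Lemma ln_le_harmonic a n : (0 < a)%N -> (a <= n)%N ->
  ln (n%:R / a%:R) <= \sum_(a <= j < n) j%:R^-1 :> R.
Proof.
move=> a0; elim: n => [|n IHn].
  by rewrite leqn0 => /eqP a00; rewrite a00 in a0.
rewrite leq_eqVlt => /predU1P[<-|]; last rewrite ltnS => an.
  by rewrite big_geq// divff ?ln1// pnatr_eq0 -lt0n.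
have n0 : (0 < n)%N := leq_trans a0 an.
rewrite big_nat_recr//=.
have -> : n.+1%:R / a%:R = n%:R / a%:R * (1 + n%:R^-1) :> R.
  by rewrite -natr1; field; rewrite !pnatr_eq0 -!lt0n n0 a0.
rewrite lnM ?posrE ?divr_gt0 ?ltr0n ?addr_gt0 ?invr_gt0 ?ltr0n//.
by rewrite lerD ?IHn// le_ln1Dx// (lt_le_trans (@ltrN10 R)) ?invr_ge0.
Qed.

End NodeSums.

(** * Sums of [ek] over equispaced nodes *)

Section NodeSumBounds.
Context {R : realType}.
Implicit Types (x y t : R).

Lemma sin_mvt t : 0 <= t -> exists2 c, 0 <= c <= t & sin t = cos c * t.
Proof.
move=> t0.
have [|c] := @MVT_segment R sin cos 0 t t0 (fun x _ => is_derive_sin x).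
  by apply: continuous_subspaceT => x; exact: continuous_sin.
by rewrite sin0 !subr0 in_itv/=; exists c.
Qed.

Lemma sin_le t : 0 <= t -> sin t <= t.
Proof.
by move=> t0; have [c _ ->] := sin_mvt t0; rewrite ler_piMl// cos_le1.
Qed.

Lemma le_cos_pi x y : 0 <= x -> x <= y -> y <= pi -> cos y <= cos x.
Proof.
move=> x0 xy ypi; rewrite leNgt ltr_cos ?in_itv/= -?leNgt//.
  by apply/andP; split; lra.
by apply/andP; split; lra.
Qed.

(** With [u = t / 2], the mean value theorem gives [sin u >= u cos u], whence [sin t = 2 sin u cos u
    >= 2 u cos^2 u = u (1 + cos t) >= u]. *)
Lemma sin_ge_half t : 0 <= t <= pi / 2 -> t / 2 <= sin t.
Proof.
move=> /andP[t0 tpi]; have pi0 := @pi_ge0 R.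
have [|c /andP[c0 ct] sE] := @sin_mvt (t / 2); first by rewrite divr_ge0.
have cc : cos (t / 2) <= cos c by apply: le_cos_pi => //; lra.
have c2 : 0 <= cos (t / 2) by apply: cos_ge0_pihalf; apply/andP; split; lra.
have ct0 : 0 <= cos t by apply: cos_ge0_pihalf; apply/andP; split; lra.
set u := t / 2 in sE cc c2 *.
have tE : t = u *+ 2 by rewrite -mulr_natr /u; lra.
have ct0' : 0 <= 2 * cos u ^+ 2 - 1 by rewrite mulr_natl -cos_mulr2n -tE.
rewrite [in leRHS]tE sin_mulr2n sE.
have u0 : 0 <= u by rewrite divr_ge0.
have : cos u * (cos u * u) <= cos u * (cos c * u).
  by rewrite ler_wpM2l// ler_wpM2r.
have := mulr_ge0 u0 ct0'.
by rewrite mulr2n; move: (cos u) (cos c) => a b; lra.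
Qed.

Lemma sin_ge_half_pi t :
  0 <= t <= pi -> t / 2 <= sin t \/ (pi - t) / 2 <= sin t.
Proof.
move=> /andP[t0 tpi]; have [h|h] := leP t (pi / 2).
  by left; apply: sin_ge_half; rewrite t0.
right; rewrite (_ : sin t = sin (pi - t)); last first.
  by rewrite sinB sinpi cospi; lra.
by apply: sin_ge_half; apply/andP; split; lra.
Qed.

(** Node [j] lies at least [j] steps to the right of [0] and [n - 1 - j] steps to the left of [pi].
    Since [n] steps make up [pi >= 2], the linear lower bounds for the sine give a denominator of at
    least [j + 1] or [n - j]. *)
Lemma ek_node_le n j y : (j < n)%N -> 0 <= y <= pi / n%:R ->
  ek n (y + j%:R * (pi / n%:R)) <= n%:R * (j.+1%:R^-1 + (n - j)%:R^-1).
Proof.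
move=> jn /andP[y0 yh]; set h := pi / _ in yh *.
have n0 : (0 < n)%N by apply: leq_ltn_trans jn.
have nR : 0 < n%:R :> R by rewrite ltr0n.
have hpi : n%:R * h = pi by rewrite mulrC divfK// lt0r_neq0.
have h0 : 0 <= h by rewrite divr_ge0 ?pi_ge0.
have key (k : nat) : k%:R * h / 2 <= sin (y + j%:R * h) ->
    ek n (y + j%:R * h) <= n%:R * k.+1%:R^-1.
  move=> hk; rewrite /ek ler_pM2l// lef_pV2 ?posrE ?ek_den_gt0//.
  rewrite -(natr1 k) addrC lerD2l.
  have : n%:R * (k%:R * h / 2) <= n%:R * `|sin (y + j%:R * h)|.
    by rewrite ler_pM2l// (le_trans hk)// ler_norm.
  apply: le_trans; have : 0 <= k%:R * (pi - 2) :> R.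
    by rewrite mulr_ge0// subr_ge0 pi_ge2.
  have -> : n%:R * (k%:R * h / 2) = k%:R * (n%:R * h) / 2 by ring.
  by rewrite hpi; move: (k%:R : R) => a; lra.
have jR : 0 <= j%:R :> R by [].
have njR : (n - j.+1)%:R * h <= pi - (y + j%:R * h).
  rewrite natrB// -(natr1 j) -hpi; move: yh.
  by move: (n%:R) (j%:R) => a b; lra.
have nj0 : 0 <= (n - j.+1)%:R * h by rewrite mulr_ge0.
have jh0 : 0 <= j%:R * h by rewrite mulr_ge0.
rewrite mulrDr.
have ha : 0 <= n%:R * j.+1%:R^-1 :> R by rewrite mulr_ge0.
have hb : 0 <= n%:R * (n - j)%:R^-1 :> R by rewrite mulr_ge0.
have [] := @sin_ge_half_pi (y + j%:R * h).
- by apply/andP; split; lra.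
- move=> hs; have : ek n (y + j%:R * h) <= n%:R * j.+1%:R^-1.
    by apply: key; lra.
  by move=> hk; rewrite (le_trans hk)// lerDl.
- move=> hs; have : ek n (y + j%:R * h) <= n%:R * (n - j.+1).+1%:R^-1.
    by apply: key; lra.
  by rewrite subnSK// => hk; rewrite (le_trans hk)// lerDr.
Qed.

Lemma sum_ek_nodes n x : (0 < n)%N ->
  \sum_(0 <= j < n) ek n (x + j%:R * (pi / n%:R)) <= 2 * n%:R * (1 + ln n%:R).
Proof.
move=> n0; set h := pi / n%:R.
have h0 : 0 < h by rewrite divr_gt0 ?pi_gt0 ?ltr0n.
pose k := Num.floor (x / h); pose y := x - k%:~R * h.
have -> : x = y + k%:~R * h by rewrite /y subrK.
rewrite sum_shift_periodic_int//; last by move=> ?; exact: ek_addpi.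
have /andP[k1 k2] := floor_itv (x / h).
have y0 : 0 <= y <= h.
  rewrite /y subr_ge0 -ler_pdivlMr// k1/= lerBlDl.
  move: k2; rewrite intrD ltr_pdivrMr// mulrDl mul1r; exact: ltW.
rewrite (@le_trans _ _
  (\sum_(0 <= j < n) n%:R * (j.+1%:R^-1 + (n - j)%:R^-1)))//.
  rewrite big_nat_cond [leRHS]big_nat_cond ler_sum// => j /andP[/andP[_ jn] _].
  exact: ek_node_le.
rewrite -big_distrr/= big_split/= -(mulrA 2) mulrCA ler_wpM2l//.
have hl := @harmonic_le_ln R n n0; rewrite big_add1/= in hl.
rewrite [X in _ + X]big_nat_rev/=.
rewrite [X in _ + X](eq_big_nat _ _ (F2 := fun j => j.+1%:R^-1)); last first.
  by move=> j /andP[_ jn]; rewrite add0n subnA// subnn.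
by lra.
Qed.

Lemma sum_ek_nodes_le n p x : (0 < p)%N -> (n <= 3 * p)%N ->
  \sum_(0 <= j < p) ek n (x + j%:R * (pi / p%:R)) <= 6 * p%:R * (1 + ln p%:R).
Proof.
move=> p0 np; rewrite (@le_trans _ _
  (\sum_(0 <= j < p) 3 * ek p (x + j%:R * (pi / p%:R))))//.
  by rewrite ler_sum// => j _; exact: ek_le.
by rewrite -big_distrr/=; have := sum_ek_nodes x p0; lra.
Qed.

End NodeSumBounds.

(** * Doubling of the nodes and polar coordinates *)

Section Sums.
Context {R : realType}.

(** Passes from the angles [phi m nu], even multiples of [pi / N], to all multiples of [pi / N] over
    two periods. *)
Lemma sum_double_le (F : nat -> R) n : (forall i, 0 <= F i) ->
  \sum_(0 <= i < n) F i.*2 <= \sum_(0 <= i < n.*2) F i.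
Proof.
move=> F0; elim: n => [|n IHn]; first by rewrite !big_geq.
rewrite doubleS big_nat_recr//= big_nat_recr//= [in leRHS]big_nat_recr//=.
rewrite -addrA lerD//.
by rewrite lerDl.
Qed.

Lemma polar (x y : R) : x ^+ 2 + y ^+ 2 <= 1 ->
  exists r a, [/\ 0 <= r <= 1, x = r * cos a & y = r * sin a].
Proof.
move=> xy; pose r := Num.sqrt (x ^+ 2 + y ^+ 2).
have r2 : r ^+ 2 = x ^+ 2 + y ^+ 2 by rewrite sqr_sqrtr// addr_ge0 ?sqr_ge0.
have r0 : 0 <= r by rewrite sqrtr_ge0.
have r1 : 0 <= r <= 1 by rewrite r0 -sqrtr1 ler_sqrt.
have [rz|rn] := eqVneq r 0.
  exists 0, 0; move: r2; rewrite rz expr0n/= => /esym/eqP.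
  rewrite paddr_eq0 ?sqr_ge0// !sqrf_eq0 => /andP[/eqP -> /eqP ->].
  by rewrite !mul0r lexx ler01.
have rp : 0 < r by rewrite lt_def rn.
have xr : -1 <= x / r <= 1.
  rewrite -ler_norml normrM normfV (ger0_norm r0) ler_pdivrMr// mul1r.
  rewrite -(@ler_pXn2r _ 2)// ?nnegrE// real_normK ?num_real// r2.
  by rewrite lerDl sqr_ge0.
have sE : r * sin (acos (x / r)) = `|y|.
  rewrite sin_acos// -{1}(ger0_norm r0) -sqrtr_sqr -sqrtrM ?sqr_ge0//.
  rewrite -sqrtr_sqr; congr Num.sqrt; rewrite mulrBr mulr1 -exprMn.
  by rewrite [r * _]mulrC divfK// r2 addrC addKr.
have [y0|y0] := leP 0 y.
  exists r, (acos (x / r)); split => //; first by rewrite acosK// mulrC divfK.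
  by rewrite sE ger0_norm.
exists r, (- acos (x / r)); split => //.
  by rewrite cosN acosK// mulrC divfK.
by rewrite sinN mulrN sE ltr0_norm// opprK.
Qed.

End Sums.

(** * Upper bound for the Lebesgue function *)

Section KernelSums.
Context {R : realType}.

Lemma sum_triangle_mul (a b : nat -> R) N :
  \sum_(0 <= n < N) \sum_(0 <= k < n.+1) a k * b (n - k)%N =
  \sum_(0 <= k < N) a k * \sum_(0 <= i < N - k) b i.
Proof.
elim: N => [|N IHN]; first by rewrite !big_geq.
rewrite big_nat_recr//= IHN [RHS]big_nat_recr//= subSnn big_nat1.
rewrite [X in _ + X]big_nat_recr//= subnn addrA; congr (_ + _).
rewrite -big_split/=; apply: eq_big_nat => k /andP[_ kN].
by rewrite subSn 1?ltnW// big_nat_recr//= mulrDr.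
Qed.

Lemma sum_chebTt p (a b : R) :
  \sum_(0 <= i < p.+1) (chebTt R i).[cos a] * (chebTt R i).[cos b] =
  (dirichlet p (a + b) + dirichlet p (a - b)) / 2.
Proof.
elim: p => [|p IHp].
  by rewrite big_nat1 !dirichlet0 /chebTt !hornerC mulr1; lra.
rewrite big_nat_recr//= IHp !dirichletS.
have -> : (Num.sqrt 2 *: chebT R p.+1).[cos a] *
    (Num.sqrt 2 *: chebT R p.+1).[cos b] =
  (Num.sqrt 2 ^+ 2) * (cos (p.+1%:R * a) * cos (p.+1%:R * b)) :> R.
  by rewrite !hornerZ !chebT_cos; ring.
rewrite sqr_sqrtr// mul_cos -mulrDr -mulrBr; lra.
Qed.

Lemma kernelT_Qsum m nu j l (p : R * R * R) z : p.2 = cos z ->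
  kernelT m nu j l p = (2 * m * (2 * m + 1) ^ 2)%:R^-1 / 2 *
    (Qsum (2 * m + 1) (theta m j) (sigma m nu p.1) (gamma m l + z) +
     Qsum (2 * m + 1) (theta m j) (sigma m nu p.1) (gamma m l - z)).
Proof.
move=> pz; rewrite /kernelT div1r -mulrA; congr (_ * _).
pose a k := k.+1%:R * sin (k.+1%:R * theta m j) * cheb_s (sigma m nu p.1) k.+1.
pose b i := (chebTt R i).[cos (gamma m l)] * (chebTt R i).[cos z].
rewrite (eq_bigr (fun n => \sum_(0 <= k < n.+1) a k * b (n - k)%N)); last first.
  move=> n _; rewrite addn1; apply: eq_bigr => k _.
  by rewrite /a /b addn1 pz /znode [RHS]mulrA.
rewrite sum_triangle_mul /Qsum -big_split big_distrr/=.
apply: eq_big_nat => k /andP[_ kN].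
have -> : (2 * m + 1 - k = (2 * m + 1 - k.+1).+1)%N by lia.
by rewrite sum_chebTt /a; ring.
Qed.

Definition lebesgue_function m (p : R * R * R) : R :=
  \sum_(0 <= nu < 2 * m + 1) \sum_(1 <= j < 2 * m + 1) \sum_(0 <= l < 2 * m)
    2 * sin (theta m j) * `|kernelT m nu j l p|.

Lemma theta_itv m j : (j < 2 * m + 1)%N -> 0 <= @theta R m j <= pi.
Proof.
move=> jm; rewrite /theta divr_ge0 ?mulr_ge0 ?pi_ge0//=.
rewrite mulrAC ler_piMl ?pi_ge0// ler_pdivrMr ?mul1r ?ltr0n ?addn1//.
by rewrite ler_nat; lia.
Qed.

Lemma sin_theta_ge0 m j : (j < 2 * m + 1)%N -> 0 <= sin (theta m j) :> R.
Proof. by move=> jm; rewrite sin_ge0_pi// theta_itv. Qed.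

(** For [q = r (cos a, sin a)] the cosine of [sigma] is [r cos (phi - a)] with [r <= 1], so [sigma]
    is no closer to a zero of the sine than the equispaced angle [phi - a]. *)
Lemma norm_sin_sigma (q : R * R) : disk q -> exists a : R, forall m nu,
  `|sin (phi m nu - a)| <= `|sin (sigma m nu q)|.
Proof.
case: q => x y /polar[r [a [/andP[r0 r1] /= xE yE]]]; exists a => m nu.
rewrite /sigma/= xE yE.
set f := phi m nu.
have -> : r * cos a * cos f + r * sin a * sin f = r * cos (f - a).
  by rewrite cosB; ring.
set u := r * _.
have u1 : `|u| <= `|cos (f - a)|.
  by rewrite /u normrM ler_piMl// ger0_norm.
have hu : -1 <= u <= 1 by rewrite -ler_norml (le_trans u1)// cos_max.
rewrite -(@ler_pXn2r _ 2)// ?nnegrE// !real_normK ?num_real//.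
rewrite !sin2cos2 acosK// lerD2l lerN2 -(real_normK (num_real u)).
by rewrite -[leRHS]real_normK ?num_real// ler_pXn2r ?nnegrE.
Qed.

Lemma ek_anti n (x y : R) : `|sin x| <= `|sin y| -> ek n y <= ek n x.
Proof.
move=> xy; rewrite /ek ler_wpM2l// lef_pV2 ?posrE ?ek_den_gt0// lerD2l.
by rewrite ler_wpM2l.
Qed.

(* Bound for the sum of [ek (2 * m + 2)] over any of the three node systems. *)
Definition node_bound m : R :=
  6 * (2 * m + 1)%:R * (1 + ln (2 * m + 1)%:R).

Lemma node_bound_ge m : (2 * m + 1)%:R <= node_bound m.
Proof.
have : 0 <= ln (2 * m + 1)%:R :> R by rewrite ln_ge0// ler1n addn1.
rewrite /node_bound; have : 0 <= (2 * m + 1)%:R :> R by [].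
move: ((2 * m + 1)%:R : R) (ln _) => a b a0 b0.
by have := mulr_ge0 a0 b0; lra.
Qed.

Section FixedOrder.
Variable m : nat.
Hypothesis m_gt0 : (0 < m)%N.
Let N := (2 * m + 1)%N.
Let n := (2 * m + 2)%N.

Lemma sum_ek_theta (c : R) :
  \sum_(1 <= j < N) ek n (theta m j + c) <= node_bound m.
Proof.
have N0 : (0 < N)%N by rewrite /N addn1.
have nN : (n <= 3 * N)%N by rewrite /n /N; lia.
apply: le_trans (sum_ek_nodes_le c N0 nN); rewrite (big_ltn N0)/=.
rewrite (eq_bigr (fun j => ek n (c + j%:R * (pi / N%:R)))).
  by rewrite lerDr ek_ge0.
by move=> j _; rewrite /theta addrC mulrA.
Qed.

Lemma sum_ek_gamma (c : R) :
  \sum_(0 <= l < 2 * m) ek n (gamma m l + c) <= node_bound m.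
Proof.
have M0 : (0 < 2 * m)%N by lia.
have nM : (n <= 3 * (2 * m))%N by rewrite /n; lia.
apply: (le_trans _ (le_trans (sum_ek_nodes_le (c + pi / (4 * m)%:R) M0 nM) _)).
  rewrite le_eqVlt; apply/orP; left; apply/eqP; apply: eq_bigr => l _.
  congr (ek n _); rewrite /gamma natrD !natrM; field.
  by rewrite !pnatr_eq0 -!lt0n m_gt0.
have l0 : (1 : R) <= (2 * m)%:R by rewrite ler1n.
have lN : (2 * m)%:R <= N%:R :> R by rewrite ler_nat /N leq_addr.
rewrite /node_bound -/N ler_pM ?mulr_ge0 ?addr_ge0 ?ln_ge0//.
  by rewrite ler_wpM2l.
by rewrite lerD2l ler_ln ?posrE// (lt_le_trans ltr01)// (le_trans l0).
Qed.

Lemma sum_ek_sigma (q : R * R) : disk q ->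
  \sum_(0 <= nu < N) ek n (sigma m nu q) <= 2 * node_bound m.
Proof.
move=> /norm_sin_sigma[a ha].
pose F j := ek n (- a + j%:R * (pi / N%:R)).
have N0 : (0 < N)%N by rewrite /N addn1.
(* The angles [phi m nu] are the even nodes of step [pi / N]; all [2 N] nodes cover two periods,
   each summing to at most [node_bound m]. *)
apply: (@le_trans _ _ (\sum_(0 <= nu < N) F nu.*2)).
  rewrite ler_sum// => nu _; rewrite (le_trans (ek_anti _ (ha m nu)))//.
  rewrite /F le_eqVlt; apply/orP; left; apply/eqP; congr (ek n _).
  by rewrite /phi -mul2n natrM -/N; ring.
rewrite (le_trans (sum_double_le _ _))// => [i|]; first exact: ek_ge0.
rewrite -addnn (big_cat_nat (n := N))/= ?leq_addr//.
have h c := @sum_ek_nodes_le R n N c N0.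
have nN : (n <= 3 * N)%N by rewrite /n /N; lia.
have -> : 2 * node_bound m = node_bound m + node_bound m by ring.
rewrite lerD//; first exact: h.
rewrite -{1}[N]add0n big_addn addnK (le_trans _ (h (- a) nN))//.
rewrite le_eqVlt; apply/orP; left; apply/eqP; apply: eq_bigr => j _.
rewrite /F natrD mulrDl [N%:R * _]mulrC divfK ?pnatr_eq0 -?lt0n//.
by rewrite addrA ek_addpi.
Qed.

Lemma sum_sin_Qsum (q : R * R) (w : R) : disk q ->
  \sum_(0 <= nu < N) \sum_(1 <= j < N) \sum_(0 <= l < 2 * m)
    `|sin (theta m j) * Qsum N (theta m j) (sigma m nu q) (gamma m l + w)|
  <= 36 * n%:R * (16 * N%:R * node_bound m ^+ 2).
Proof.
move=> dq; set G := node_bound m.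
have NG : N%:R <= G := node_bound_ge m.
have G0 : 0 <= G by rewrite (le_trans _ NG).
(* The sum over [j] goes first: every [ek] involving [theta m j] runs over a translated node system,
   so its sum is at most [G] whatever [sigma] and [gamma] are. Each term keeps one [ek], for the sum
   over [l] or [nu]. *)
have step nu l : \sum_(1 <= j < N)
    `|sin (theta m j) * Qsum N (theta m j) (sigma m nu q) (gamma m l + w)|
    <= 36 * n%:R * (G * (6 * ek n (gamma m l + w) + 5 * ek n (sigma m nu q))).
  set s := sigma m nu q; set b := gamma m l + w.
  apply: (@le_trans _ _ (\sum_(1 <= j < N) 36 * n%:R *
    (ek n b * (ek3 n (theta m j + s) b + ek3 n (theta m j - s) b) +
     ek n s * (ek4 n (theta m j) s b + 1)))).
    rewrite ler_sum// => j _.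
    by have := norm_Qsum_le (2 * m) (theta m j) s b; rewrite /N /n addn1 addn2.
  rewrite -big_distrr ler_wpM2l ?mulr_ge0//= big_split/= -!big_distrr/=.
  rewrite /ek3 /ek4 !big_split/= big_const_nat iter_addr addr0.
  have h c : \sum_(1 <= j < N) ek n (theta m j + c) <= G := sum_ek_theta c.
  have h2 c d : \sum_(1 <= j < N) ek n (theta m j + c + d) <= G.
    by under eq_bigr do rewrite -addrA; exact: h.
  have eb := ek_ge0 n b; have es := ek_ge0 n s.
  have -> : G * (6 * ek n b + 5 * ek n s) =
    ek n b * (G + G + G + (G + G + G)) + ek n s * (G + G + (G + G) + G) by ring.
  rewrite lerD// ler_wpM2l//.
    by rewrite !lerD.
  rewrite !lerD// (le_trans _ NG)// ler_nat subn1; lia.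
rewrite (eq_bigr (fun nu => \sum_(0 <= l < 2 * m) \sum_(1 <= j < N)
    `|sin (theta m j) * Qsum N (theta m j) (sigma m nu q)
      (gamma m l + w)|)); last first.
  by move=> nu _; rewrite exchange_big.
apply: (@le_trans _ _ (\sum_(0 <= nu < N) 36 * n%:R *
    (G * (6 * G + 5 * N%:R * ek n (sigma m nu q))))).
  rewrite ler_sum// => nu _.
  apply: (le_trans (ler_sum _ (fun l _ => step nu l))).
  rewrite -big_distrr ler_wpM2l ?mulr_ge0//= -big_distrr ler_wpM2l//=.
  rewrite big_split/= -big_distrr/= lerD//.
    by rewrite ler_wpM2l// sum_ek_gamma.
  rewrite big_const_nat iter_addr addr0 subn0 -[leLHS]mulr_natr mulrAC.
  rewrite ler_wpM2r ?ek_ge0// ler_wpM2l// ler_nat /N; lia.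
rewrite -big_distrr ler_wpM2l ?mulr_ge0//= -big_distrr/= big_split/=.
have -> : 16 * N%:R * G ^+ 2 =
  G * (N%:R * (6 * G) + 5 * N%:R * (2 * G)) by ring.
rewrite ler_wpM2l// lerD//.
  by rewrite big_const_nat iter_addr addr0 subn0 -[leLHS]mulr_natl.
by rewrite -big_distrr ler_wpM2l ?mulr_ge0//= sum_ek_sigma.
Qed.

End FixedOrder.

(** Here [L] stands for [ln (m + 1)] and [l] for [ln N]. With [G <= 24 N L] the left side is of
    order [N^2 L^2 / m]. The constant collects [1152 = 2 * 36 * 16], [576 = 24 ^ 2] and [9] from
    [N <= 3 m], where [576 * 9 = 36 * 144]. *)
Lemma lebesgue_constant_arith (n N m G L l : R) : 0 < m -> 0 < N ->
  N <= 3 * m -> 0 <= n -> n <= 2 * N -> 1 / 2 <= L -> 0 <= G ->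
  G = 6 * N * (1 + l) -> l <= 2 * L ->
  (2 * m * N ^+ 2)^-1 * (2 * (36 * n * (16 * N * G ^+ 2))) <=
  1152 * 36 * 144 * m * L ^+ 2.
Proof.
move=> m0 NR N3 n0 nN L2 G0 GE lL; set K := _^-1.
have N0 := ltW NR.
have K0 : 0 <= K by rewrite invr_ge0 mulr_ge0 ?sqr_ge0// mulr_ge0 ?ltW.
have L0 : 0 <= L by lra.
have GL : G <= 24 * (N * L).
  have : N * (1 + l) <= N * (4 * L) by apply: ler_wpM2l => //; lra.
  by rewrite GE; lra.
have GG : G ^+ 2 <= (24 * (N * L)) ^+ 2.
  by rewrite ler_pXn2r ?nnegrE// (le_trans G0).
have nG : n * (N * G ^+ 2) <= 2 * N * (N * (24 * (N * L)) ^+ 2).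
  by apply: ler_pM => //; [exact: mulr_ge0 N0 (sqr_ge0 _)|exact: ler_wpM2l].
have -> : K * (2 * (36 * n * (16 * N * G ^+ 2))) =
  1152 * (K * (n * (N * G ^+ 2))) by ring.
have -> : 1152 * 36 * 144 * m * L ^+ 2 =
  1152 * (576 * (9 * m * L ^+ 2)) by ring.
apply: (ler_wpM2l (ler0n R 1152)); apply: (le_trans (ler_wpM2l K0 nG)).
have -> : K * (2 * N * (N * (24 * (N * L)) ^+ 2)) =
    576 * ((2 * K * N ^+ 4) * L ^+ 2) by ring.
have -> : 2 * K * N ^+ 4 = N * N / m by rewrite /K; field; rewrite !lt0r_neq0.
apply: (ler_wpM2l (ler0n R 576)); apply: (ler_wpM2r (sqr_ge0 L)).
rewrite ler_pdivrMr//.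
have -> : 9 * m * m = 3 * m * (3 * m) by ring.
by rewrite ler_pM.
Qed.

Lemma lebesgue_function_le m (p : R * R * R) : (0 < m)%N -> cylinder R p ->
  lebesgue_function m p <= 1152 * 36 * 144 * m%:R * ln (m%:R + 1) ^+ 2.
Proof.
move=> m0 [dp zp]; set N := (2 * m + 1)%N; set n := (2 * m + 2)%N.
have mN : (m.+1 <= N)%N by rewrite /N; lia.
have Nm2 : (N <= m.+1 ^ 2)%N by rewrite /N; nia.
have N3m : (N <= 3 * m)%N by rewrite /N; lia.
have n2N : (n <= 2 * N)%N by rewrite /n /N; lia.
have pz : p.2 = cos (acos p.2) by rewrite acosK.
set z := acos p.2 in pz.
have mR : 0 < m%:R :> R by rewrite ltr0n.
have NR : 0 < N%:R :> R by rewrite ltr0n /N addn1.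
pose K : R := (2 * m * N ^ 2)%:R^-1.
have K0 : 0 <= K by rewrite invr_ge0.
pose S w := \sum_(0 <= nu < N) \sum_(1 <= j < N) \sum_(0 <= l < 2 * m)
  `|sin (theta m j) * Qsum N (theta m j) (sigma m nu p.1) (gamma m l + w)|.
have h1 : lebesgue_function m p <= K * (S z + S (- z)).
  rewrite /S -!big_split/= big_distrr/= ler_sum// => nu _.
  rewrite -big_split/= big_distrr/= big_nat_cond [leRHS]big_nat_cond.
  rewrite ler_sum// => j /andP[/andP[_ jN] _].
  rewrite -big_split/= big_distrr/= ler_sum// => l _.
  have s0 := sin_theta_ge0 jN; rewrite (kernelT_Qsum _ _ _ _ pz) -/N -/K.
  rewrite !normrM (ger0_norm s0) (ger0_norm K0) (ger0_norm (_ : 0 <= 2^-1))//.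
  have := ler_normD (Qsum N (theta m j) (sigma m nu p.1) (gamma m l + z))
                    (Qsum N (theta m j) (sigma m nu p.1) (gamma m l - z)).
  move: `|_ + _| `|Qsum _ _ _ _| `|Qsum _ _ _ _| => y1 y2 y3 y123.
  have -> : 2 * sin (theta m j) * (K / 2 * y1) = K * (sin (theta m j) * y1).
    by lra.
  by rewrite ler_wpM2l// -mulrDr ler_wpM2l.
apply: (le_trans h1).
have hS w := sum_sin_Qsum m0 w dp.
apply: (@le_trans _ _
  (K * (2 * (36 * n%:R * (16 * N%:R * node_bound m ^+ 2))))).
  by rewrite ler_wpM2l// mulr_natl mulr2n lerD// hS.
set L := ln (m%:R + 1).
have mL : m%:R + 1 <= N%:R :> R by rewrite natr1 ler_nat.
(* This absorbs the summand [1] of [1 + ln N]. It comes from [ln 2 >= 1 / 2], that is,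
   [ln (1 - 1 / 2) <= - 1 / 2]. *)
have L2 : 1 / 2 <= L.
  have := @le_ln1Dx R (- (1 / 2)); have -> : 1 + - (1 / 2) = 2^-1 :> R by lra.
  rewrite lnV ?posrE// => h; have : 1 / 2 <= ln 2 :> R.
    by rewrite -lerN2; apply: h; lra.
  move/le_trans; apply; rewrite ler_ln ?posrE ?addr_gt0//.
  by rewrite natr1 ler_nat.
have NL : ln N%:R <= 2 * L.
  have -> : 2 * L = ln ((m%:R + 1) ^+ 2) by rewrite lnXn ?addr_gt0// mulr_natl.
  rewrite ler_ln ?posrE ?exprn_gt0 ?addr_gt0//.
  by rewrite natr1 -natrX ler_nat.
have -> : K = (2 * m%:R * N%:R ^+ 2)^-1 by rewrite /K !natrM.
apply: (@lebesgue_constant_arith _ _ _ _ _ (ln N%:R)) => //.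
- by rewrite -natrM ler_nat.
- by rewrite -natrM ler_nat.
- exact: le_trans (ltW NR) (node_bound_ge m).
Qed.

End KernelSums.

(** * The operator norm and the Lebesgue function *)

Section OperatorNorm.
Context {R : realType}.
Implicit Types (f : R * R * R -> R) (p : R * R * R) (a t s z : R).

Definition chord (a t s : R) : R * R :=
  (t * cos a + s * sin a, t * sin a - s * cos a).

Lemma continuous_chord a t : continuous (chord a t).
Proof.
move=> s; apply: (@cvg_pair _ _ _ _ (nbhs _) (nbhs _)) => /=.
  apply: cvgD; first exact: cvg_cst.
  by apply: cvgM; [exact: cvg_id|exact: cvg_cst].
apply: cvgB; first exact: cvg_cst.
by apply: cvgM; [exact: cvg_id|exact: cvg_cst].
Qed.

Lemma chord_disk a t s : t ^+ 2 + s ^+ 2 <= 1 -> disk (chord a t s).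
Proof.
rewrite /disk/=.
have -> : (t * cos a + s * sin a) ^+ 2 + (t * sin a - s * cos a) ^+ 2 =
  (t ^+ 2 + s ^+ 2) * (cos a ^+ 2 + sin a ^+ 2) by ring.
by rewrite cos2Dsin2 mulr1.
Qed.

Lemma chord_itv t s : -1 <= t <= 1 ->
  - Num.sqrt (1 - t ^+ 2) <= s <= Num.sqrt (1 - t ^+ 2) -> t ^+ 2 + s ^+ 2 <= 1.
Proof.
move=> t1; rewrite -ler_norml => hs.
have t2 : 0 <= 1 - t ^+ 2.
  by rewrite subr_ge0 -(real_normK (num_real t)) expr_le1// ler_norml.
rewrite -lerBrDl -(real_normK (num_real s)) -[leRHS](sqr_sqrtr t2).
by rewrite ler_pXn2r ?nnegrE ?sqrtr_ge0.
Qed.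

Definition chord_range (t : R) : set R :=
  `[- Num.sqrt (1 - t ^+ 2), Num.sqrt (1 - t ^+ 2)].

Lemma continuous_on_chord f a t z : -1 <= t <= 1 -> -1 <= z <= 1 ->
  {within cylinder R, continuous f} ->
  {within chord_range t, continuous (fun s => f (chord a t s, z))}.
Proof.
move=> t1 z1 /subspace_continuousP cf; apply/subspace_continuousP => s.
rewrite /chord_range /= in_itv/= => hs.
have cs : cylinder R (chord a t s, z).
  by split => //; apply: chord_disk; exact: chord_itv hs.
apply: (cvg_comp _ _ _ (cf _ cs)) => A; rewrite /within/= => hA.
have hc : (chord a t x, z) @[x --> s] --> (chord a t s, z).
  apply: (@cvg_pair _ _ _ _ (nbhs (chord a t s)) (nbhs z)
    _ _ _ (chord a t) (fun=> z)).
    exact: continuous_chord.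
  exact: cvg_cst.
have {}hA : nbhs s [set x | cylinder R (chord a t x, z) -> A (chord a t x, z)].
  exact: hc hA.
apply: filterS hA => u /= hu us.
apply: hu; split => //; apply: chord_disk.
by move: us; rewrite in_itv/=; exact: chord_itv.
Qed.

Lemma integrable_chord f a t z : -1 <= t <= 1 -> -1 <= z <= 1 ->
  {within cylinder R, continuous f} ->
  lebesgue_measure.-integrable (chord_range t)
    (EFin \o (fun s => f (chord a t s, z))).
Proof.
move=> t1 z1 cf; apply: continuous_compact_integrable.
  exact: segment_compact.
exact: continuous_on_chord.
Qed.

Lemma Rintegral_cst_chord (t c : R) :
  (\int[lebesgue_measure]_(s in chord_range t) c =
   c * (2 * Num.sqrt (1 - t ^+ 2)))%R.
Proof.
rewrite Rintegral_cst; last exact: measurable_itv.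
congr (_ * _).
rewrite /chord_range/= lebesgue_measure_itv/= lte_fin.
have := sqrtr_ge0 (1 - t ^+ 2); move: (Num.sqrt _) => w w0.
case: ifPn => [_|]; first by rewrite /= opprK; ring.
by rewrite -leNgt => h; rewrite (_ : w = 0) ?mulr0//; lra.
Qed.

Lemma norm_radon_le f a t z : -1 <= t <= 1 -> -1 <= z <= 1 ->
  {within cylinder R, continuous f} ->
  (forall p, cylinder R p -> `|f p| <= 1) ->
  `|radon a (fun q => f (q, z)) t| <= 2 * Num.sqrt (1 - t ^+ 2).
Proof.
move=> t1 z1 cf f1.
have fi := integrable_chord a t1 z1 cf.
rewrite /radon; apply: le_trans.
  by apply: le_normr_Rintegral; [exact: measurable_itv|exact: fi].
rewrite -[leRHS]mul1r -Rintegral_cst_chord.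
apply: le_Rintegral.
- exact: measurable_itv.
- exact: integrable_norm fi.
- apply: continuous_compact_integrable; first exact: segment_compact.
  by apply: continuous_subspaceT => ?; exact: cvg_cst.
move=> s; rewrite /chord_range/= in_itv/= => hs; apply: f1; split => //=.
by apply: chord_disk; exact: chord_itv hs.
Qed.

Lemma unif_norm_le1 f : (unif_norm (cylinder R) f <= 1%:E)%E ->
  forall p, cylinder R p -> `|f p| <= 1.
Proof.
move=> h p cp; rewrite -lee_fin; apply: le_trans h.
by apply: ereal_sup_ubound; exists p.
Qed.

Lemma znode_itv m l : -1 <= @znode R m l <= 1.
Proof. by rewrite -ler_norml cos_max. Qed.

Lemma norm_calB_le m f p : {within cylinder R, continuous f} ->
  (forall p, cylinder R p -> `|f p| <= 1) ->
  `|calB m f p| <= lebesgue_function m p.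
Proof.
move=> cf f1; rewrite /calB (le_trans (ler_norm_sum _ _ _))//.
rewrite ler_sum// => nu _; rewrite (le_trans (ler_norm_sum _ _ _))//.
rewrite big_nat_cond [leRHS]big_nat_cond ler_sum// => j /andP[/andP[_ jm] _].
rewrite (le_trans (ler_norm_sum _ _ _))// ler_sum// => l _.
rewrite normrM ler_wpM2r//.
have := @norm_radon_le f (phi m nu) (cos (theta m j)) (znode m l).
rewrite -sin2cos2 sqrtr_sqr (ger0_norm (sin_theta_ge0 jm)).
by apply => //; rewrite -ler_norml cos_max.
Qed.

Lemma op_norm_calB_le m (C : R) :
  (forall p, cylinder R p -> lebesgue_function m p <= C) ->
  (op_norm (cylinder R) (calB m) <= C%:E)%E.
Proof.
move=> hC; apply: ub_ereal_sup => _ [f [cf f1] <-].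
apply: ub_ereal_sup => _ [p cp <-]; rewrite lee_fin (le_trans _ (hC p cp))//.
exact: norm_calB_le cf (unif_norm_le1 f1).
Qed.

End OperatorNorm.

(** * Continuous functions with prescribed values on the chords *)

Section TestFunctions.
Context {R : realType}.
Implicit Types (p : R * R * R) (t s z : R).

(** Keeps the test functions within norm 1 where several bumps overlap, without changing values
    already in [[-1, 1]]. *)
Definition clip t : R := Num.max (-1) (Num.min 1 t).

Lemma clip_itv t : -1 <= clip t <= 1.
Proof.
rewrite /clip le_max lexx ge_max ge_min lexx andbT/=; lra.
Qed.

Lemma clip_id t : -1 <= t <= 1 -> clip t = t.
Proof. by move=> /andP[t0 t1]; rewrite /clip (min_idPr t1) (max_idPr t0). Qed.

Lemma continuous_clip : continuous clip.
Proof.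
move=> t; apply: (@continuous_max R R (cst (-1)) (fun t => Num.min 1 t)).
  exact: cvg_cst.
by apply: (@continuous_min R R (cst 1) id); [exact: cvg_cst|exact: cvg_id].
Qed.

(** A tent of slope [n]: composed with a nonnegative distance it tends pointwise to the indicator of
    the zero set. *)
Definition bump (n : nat) t : R := Num.max 0 (1 - n%:R * t).

Lemma continuous_bump n : continuous (bump n).
Proof.
move=> t; apply: (@continuous_max R R (cst 0) (fun t => 1 - n%:R * t)).
  exact: cvg_cst.
apply: cvgB; first exact: cvg_cst.
by apply: cvgM; [exact: cvg_cst|exact: cvg_id].
Qed.

Lemma cvg_bump t : 0 <= t -> bump n t @[n --> \oo] --> ((t == 0)%:R : R).
Proof.
rewrite le_eqVlt => /predU1P[<-|t0].
  rewrite eqxx (_ : (bump ^~ 0) = cst 1); first exact: cvg_cst.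
  by apply/funext => n; rewrite /bump mulr0 subr0 (max_idPr ler01).
rewrite gt_eqF//=; apply: cvg_near_cst.
near=> n; rewrite /bump; apply/max_idPl; rewrite subr_le0 -ler_pdivrMr//.
near: n; exact: nbhs_infty_ger.
Unshelve. all: by end_near. Qed.

Lemma cvg_sum_nat {T : Type} {F : set_system T} {FF : Filter F}
    (f : nat -> T -> R) (g : nat -> R) a b :
  (forall i, (a <= i < b)%N -> f i x @[x --> F] --> g i) ->
  (\sum_(a <= i < b) f i x) @[x --> F] --> \sum_(a <= i < b) g i.
Proof.
move=> h; rewrite [\sum_(a <= i < b) g i]big_nat.
rewrite (_ : (fun x => \sum_(a <= i < b) f i x) =
  (fun x => \sum_(a <= i < b | (a <= i < b)%N) f i x)).
  by apply: cvg_big => // x; exact: add_continuous.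
by apply/funext => x; rewrite big_nat.
Qed.

Variables (m : nat) (eps : nat -> nat -> nat -> R).

(** The zeros form a line, not a plane: the one that carries the chord [(nu, j)] in the slice at
    height [znode m l]. *)
Definition plane_dist nu j l p : R :=
  `|p.1.1 * cos (phi m nu) + p.1.2 * sin (phi m nu) - cos (theta m j)|
  + `|p.2 - znode m l|.

Definition test_sum n p : R :=
  \sum_(0 <= nu < 2 * m + 1) \sum_(1 <= j < 2 * m + 1) \sum_(0 <= l < 2 * m)
    eps nu j l * bump n (plane_dist nu j l p).

Definition test_fun n p : R := clip (test_sum n p).

Lemma continuous_plane_dist nu j l : continuous (plane_dist nu j l).
Proof.
move=> p; apply: cvgD; apply: cvg_norm.
  apply: cvgB; last exact: cvg_cst.
  have c1 : (fun q : R * R * R => q.1.1) x @[x --> p] --> p.1.1.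
    by apply: (cvg_comp _ _ (@cvg_fst _ _ _ _ _)); exact: cvg_fst.
  have c2 : (fun q : R * R * R => q.1.2) x @[x --> p] --> p.1.2.
    by apply: (cvg_comp _ _ (@cvg_fst _ _ _ _ _)); exact: cvg_snd.
  by apply: cvgD; apply: cvgM => //; exact: cvg_cst.
by apply: cvgB; [exact: cvg_snd|exact: cvg_cst].
Qed.

Lemma continuous_test_fun n : continuous (test_fun n).
Proof.
move=> p.
apply: (cvg_comp (test_sum n) clip _ (@continuous_clip (test_sum n p))).
rewrite /test_sum; do 3 apply: cvg_sum_nat => ? _.
apply: cvgM; first exact: cvg_cst.
apply: (cvg_comp _ (bump n) _ (@continuous_bump n _)).
exact: continuous_plane_dist.
Qed.

Lemma norm_test_fun_le1 n p : `|test_fun n p| <= 1.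
Proof. by rewrite ler_norml; exact: clip_itv. Qed.

Lemma sum_nat_single (F : nat -> R) a b i : (a <= i < b)%N ->
  (forall k, (a <= k < b)%N -> k != i -> F k = 0) ->
  \sum_(a <= k < b) F k = F i.
Proof.
move=> iab F0; rewrite (bigD1_seq i) ?mem_index_iota ?iota_uniq//=.
rewrite big_seq_cond big1 ?addr0// => k /andP[].
by rewrite mem_index_iota; exact: F0.
Qed.

Lemma cvg_test_fun nu0 j0 l0 p : `|eps nu0 j0 l0| <= 1 ->
  (nu0 < 2 * m + 1)%N -> (1 <= j0 < 2 * m + 1)%N -> (l0 < 2 * m)%N ->
  plane_dist nu0 j0 l0 p = 0 ->
  (forall nu j l, (nu < 2 * m + 1)%N -> (1 <= j < 2 * m + 1)%N ->
    (l < 2 * m)%N -> plane_dist nu j l p = 0 ->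
    [/\ nu = nu0, j = j0 & l = l0]) ->
  test_fun n p @[n --> \oo] --> eps nu0 j0 l0.
Proof.
move=> e1 nu0m j0m l0m p0 pn.
have -> : eps nu0 j0 l0 = clip (\sum_(0 <= nu < 2 * m + 1)
  \sum_(1 <= j < 2 * m + 1) \sum_(0 <= l < 2 * m)
    eps nu j l * (plane_dist nu j l p == 0)%:R).
  rewrite (@sum_nat_single _ _ _ nu0)//; last first.
    move=> nu /andP[_ num] nun; rewrite big_nat big1// => j jm.
    rewrite big_nat big1// => l lm; case: eqP => [h|]; last by rewrite mulr0.
    by have [nuE] := pn _ _ _ num jm lm h; rewrite nuE eqxx in nun.
  rewrite (@sum_nat_single _ _ _ j0)//; last first.
    move=> j jm jn; rewrite big_nat big1// => l lm.
    case: eqP => [h|]; last by rewrite mulr0.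
    by have [_ jE] := pn _ _ _ nu0m jm lm h; rewrite jE eqxx in jn.
  rewrite (@sum_nat_single _ _ _ l0)//; last first.
    move=> l lm ln; case: eqP => [h|]; last by rewrite mulr0.
    by have [_ _ lE] := pn _ _ _ nu0m j0m lm h; rewrite lE eqxx in ln.
  by rewrite p0 eqxx mulr1 clip_id// -ler_norml.
apply: (cvg_comp (fun n => test_sum n p) clip _ (@continuous_clip _)).
rewrite /test_sum; do 3 apply: cvg_sum_nat => ? _.
apply: cvgM; first exact: cvg_cst.
by apply: cvg_bump; rewrite addr_ge0.
Qed.

(** Distinct directions are never parallel: the angles differ by [2 d pi / N] with [0 < d < N], and
    the odd number [N] does not divide [2 d]. *)
Lemma sin_phi_sub_neq0 nu nu' : (nu < 2 * m + 1)%N -> (nu' < 2 * m + 1)%N ->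
  nu != nu' -> sin (phi m nu - phi m nu') != 0 :> R.
Proof.
wlog lt : nu nu' / (nu' < nu)%N.
  move=> hw h h' ne; have /orP[lt|lt] : ((nu' < nu) || (nu < nu'))%N by lia.
    exact: hw.
  by rewrite -opprB sinN oppr_eq0 hw// eq_sym.
move=> h h' _.
have NR : 0 < (2 * m + 1)%:R :> R by rewrite ltr0n addn1.
have pp := @pi_gt0 R.
have pE (d : nat) :
  (d%:R * (pi / (2 * m + 1)%:R) < pi :> R) = (d < 2 * m + 1)%N.
  by rewrite mulrA ltr_pdivrMr// [pi * _]mulrC ltr_pM2r// ltr_nat.
have h0 (d : nat) : (0 < d < 2 * m + 1)%N ->
    sin (d%:R * (pi / (2 * m + 1)%:R)) != 0 :> R.
  move=> /andP[d0 dm]; rewrite gt_eqF// sin_gt0_pi// pE dm andbT.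
  by rewrite mulr_gt0 ?divr_gt0// ltr0n.
have -> : phi m nu - phi m nu' =
  (2 * (nu - nu'))%:R * (pi / (2 * m + 1)%:R) :> R.
  by rewrite /phi natrM natrB ?(ltnW lt)//; ring.
have [hd|hd] := ltnP (2 * (nu - nu')) (2 * m + 1); first by apply: h0; lia.
have -> : (2 * (nu - nu'))%:R * (pi / (2 * m + 1)%:R) =
  (2 * (nu - nu') - (2 * m + 1))%:R * (pi / (2 * m + 1)%:R) + pi :> R.
  rewrite natrB// mulrBl [X in _ - X + _]mulrC divfK ?subrK// gt_eqF//.
by rewrite sinDpi oppr_eq0 h0//; lia.
Qed.

Lemma cos_theta_inj j j' : (j < 2 * m + 1)%N -> (j' < 2 * m + 1)%N ->
  cos (theta m j) = cos (theta m j') :> R -> j = j'.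
Proof.
move=> jm jm' /cos_inj; rewrite !in_itv/= !theta_itv// => /(_ isT isT).
rewrite /theta => /(mulIf _) h; have {}h := h _.
apply/eqP; rewrite -(eqr_nat R); apply/eqP.
apply: (@mulIf _ pi); first by rewrite gt_eqF ?pi_gt0.
by apply: h; rewrite invr_eq0 pnatr_eq0 addn1.
Qed.

Lemma gamma_itv l : (l < 2 * m)%N -> 0 <= @gamma R m l <= pi.
Proof.
move=> lm; rewrite /gamma mulr_ge0 ?divr_ge0 ?pi_ge0//=.
rewrite ler_piMl ?pi_ge0// ler_pdivrMr ?mul1r ?ltr0n; last by lia.
by rewrite ler_nat; lia.
Qed.

Lemma znode_inj l l' : (l < 2 * m)%N -> (l' < 2 * m)%N ->
  znode m l = znode m l' :> R -> l = l'.
Proof.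
move=> lm lm' /cos_inj; rewrite !in_itv/= !gamma_itv// => /(_ isT isT).
rewrite /gamma => /(mulIf (lt0r_neq0 (@pi_gt0 R))) /(mulIf _) h.
have /eqP : (2 * l + 1)%:R = (2 * l' + 1)%:R :> R.
  by apply: h; rewrite invr_eq0 pnatr_eq0; lia.
by rewrite eqr_nat => /eqP; lia.
Qed.

End TestFunctions.

(** * The operator norm dominates the Lebesgue function *)

Section LowerNorm.
Context {R : realType}.
Implicit Types (p : R * R * R) (t s z : R).

(** Dominated convergence along the chord: off the finitely many points where the other lines cross
    it, the integrand tends to [eps nu0 j0 l0]. *)
Lemma cvg_radon_test m eps nu0 j0 l0 :
  (forall nu j l, `|eps nu j l| <= 1 :> R) ->
  (nu0 < 2 * m + 1)%N -> (1 <= j0 < 2 * m + 1)%N -> (l0 < 2 * m)%N ->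
  radon (phi m nu0) (fun q => test_fun m eps n (q, znode m l0))
    (cos (theta m j0)) @[n --> \oo] --> eps nu0 j0 l0 * (2 * sin (theta m j0)).
Proof.
move=> e1 nu0m j0m l0m.
have j0N : (j0 < 2 * m + 1)%N by case/andP: j0m.
set a := phi m nu0; set t := cos _; set z := znode m l0.
have t1 : -1 <= t <= 1 by rewrite -ler_norml cos_max.
have z1 : -1 <= z <= 1 := znode_itv m l0.
have cte n : {within cylinder R, continuous (test_fun m eps n)}.
  by apply: continuous_subspaceT => p; exact: continuous_test_fun.
have cint (c : R) :
  lebesgue_measure.-integrable (chord_range t) (EFin \o cst c).
  apply: continuous_compact_integrable; first exact: segment_compact.
  by apply: continuous_subspaceT => ?; exact: cvg_cst.
(* The parameter at which the chord meets the line [(k.1, k.2)]. For [k.1 = nu0] the denominator is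
   [sin 0] and the quotient is 0 by convention, which adds at most one harmless point to [B]. *)
pose crossing (k : nat * nat) : R :=
  (cos (theta m k.2) - t * cos (a - phi m k.1)) / sin (a - phi m k.1).
pose B := crossing @` (`I_(2 * m + 1) `*` `I_(2 * m + 1)).
have cB : countable B.
  by apply: finite_set_countable; apply: finite_image; exact: finite_setX.
have plane nu s :
  (chord a t s).1 * cos (phi m nu) + (chord a t s).2 * sin (phi m nu) =
  t * cos (a - phi m nu) + s * sin (a - phi m nu).
  by rewrite /chord/= cosB sinB; ring.
have off s : ~ B s ->
    test_fun m eps n (chord a t s, z) @[n --> \oo] --> eps nu0 j0 l0.
  move=> nB; apply: cvg_test_fun => //.
    rewrite /plane_dist /= -/z subrr normr0 addr0.
    by rewrite plane subrr cos0 sin0 mulr1 mulr0 addr0 subrr normr0.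
  move=> nu j l num /andP[_ jm] lm /eqP; rewrite /plane_dist/= paddr_eq0//.
  rewrite !normr_eq0 !subr_eq0 plane => /andP[/eqP pE /eqP zE].
  have lE := znode_inj l0m lm zE.
  have [nuE|nun] := eqVneq nu nu0.
    split => //; move: pE; rewrite nuE subrr cos0 sin0 mulr1 mulr0 addr0.
    by move/(cos_theta_inj j0N jm).
  exfalso; apply: nB; exists (nu, j) => //=.
  rewrite /crossing/= -pE addrC addKr mulfK//.
  by rewrite sin_phi_sub_neq0// eq_sym.
have DCT := @dominated_convergence _ _ R (@lebesgue_measure R) (chord_range t)
  (measurable_itv _) (fun n s => (test_fun m eps n (chord a t s, z))%:E)
  (cst (eps nu0 j0 l0)%:E) (cst 1%E).
have [|||||_ _] := DCT.
- by move=> n; apply: measurable_int (integrable_chord a t1 z1 (cte n)).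
- exact: measurable_cst.
- exists B; split.
  + by apply: countable_measurable cB => ?; exact: measurable_set1.
  + exact: countable_lebesgue_measure0.
  move=> s /= ns; apply: contrapT => nB; apply: ns => _.
  by apply: cvg_EFin; [exact: nearW|exact: off].
- exact: (cint 1).
- apply: aeW => s n _ /=; rewrite lee_fin; exact: norm_test_fun_le1.
move=> /= lim.
have limE : (\int[lebesgue_measure]_(s in chord_range t) (eps nu0 j0 l0)%:E)%E =
    (eps nu0 j0 l0 * (2 * sin (theta m j0)))%:E.
  rewrite -(ger0_norm (sin_theta_ge0 j0N)) -sqrtr_sqr sin2cos2 -/t.
  rewrite -Rintegral_cst_chord fineK//.
  apply: integrable_fin_num; first exact: measurable_itv.
  exact: (cint (eps nu0 j0 l0)).
by rewrite limE in lim; exact: fine_cvg lim.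
Qed.

Lemma cvg_calB_test m eps p : (forall nu j l, `|eps nu j l| <= 1 :> R) ->
  calB m (test_fun m eps n) p @[n --> \oo] -->
  \sum_(0 <= nu < 2 * m + 1) \sum_(1 <= j < 2 * m + 1) \sum_(0 <= l < 2 * m)
    eps nu j l * (2 * sin (theta m j)) * kernelT m nu j l p.
Proof.
move=> e1; rewrite /calB.
apply: cvg_sum_nat => nu num; apply: cvg_sum_nat => j jm.
apply: cvg_sum_nat => l lm.
by apply: cvgM; [exact: cvg_radon_test|exact: cvg_cst].
Qed.

Lemma op_norm_ge_lebesgue_function m p : cylinder R p ->
  ((lebesgue_function m p)%:E <= op_norm (cylinder R) (calB m))%E.
Proof.
(* These signs turn every term of the limit in [cvg_calB_test] into the absolute value found in the
   Lebesgue function. *)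
move=> cp; pose eps nu j l := Num.sg (kernelT m nu j l p).
have e1 nu j l : `|eps nu j l| <= 1 by rewrite normr_sg; case: eqP.
have := @cvg_calB_test m eps p e1.
set L := \sum_(0 <= nu < _) _.
have -> : L = lebesgue_function m p.
  apply: eq_bigr => nu _; apply: eq_bigr => j _; apply: eq_bigr => l _.
  by rewrite normrEsg /eps; ring.
move=> lim; apply/lee_addgt0Pr => e e0.
have /cvgrPdist_lt/(_ _ e0)[n _ /(_ n (leqnn n))/= h] := lim.
have hB :
  (`|calB m (test_fun m eps n) p|%:E <= op_norm (cylinder R) (calB m))%E.
  apply: (@le_trans _ _ (unif_norm (cylinder R) (calB m (test_fun m eps n)))).
    by apply: ereal_sup_ubound; exists p.
  apply: ereal_sup_ubound; exists (test_fun m eps n) => //; split.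
    by apply: continuous_subspaceT => q; exact: continuous_test_fun.
  by apply: ub_ereal_sup => _ [q _ <-]; rewrite lee_fin norm_test_fun_le1.
apply: (@le_trans _ _ (`|calB m (test_fun m eps n) p| + e)%:E).
  rewrite lee_fin; have := ler_norm (calB m (test_fun m eps n) p).
  have := ler_norm (lebesgue_function m p - calB m (test_fun m eps n) p).
  by move: h; lra.
by rewrite EFinD leeD2r.
Qed.

End LowerNorm.

(** * The lower bound *)

Section LowerKernel.
Context {R : realType}.
Implicit Types (x t a c A : R).

(** After division the cosine term has size [N / sin (x / 2)], while the two sines contribute only
    [1 / sin (x / 2) ^ 2]: an error term once [N * sin (x / 2)] is large. *)
Lemma sum_k_sin A x N :
  4 * sin (x / 2) ^+ 2 * \sum_(0 <= k < N) k.+1%:R * sin (A + k.+1%:R * x) =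
  sin (A + N%:R * x) - sin A
  - 2 * N%:R * sin (x / 2) * cos (A + N%:R * x + x / 2).
Proof.
elim: N => [|N IHN]; first by rewrite big_geq// mul0r addr0; ring.
rewrite big_nat_recr//= mulrDr IHN.
set h := x / 2; set B := A + N.+1%:R * x.
have -> : A + N%:R * x + h = B - h by rewrite /B -(natr1 N) /h; lra.
have -> : A + N%:R * x = B - h - h by rewrite /B -(natr1 N) /h; lra.
have -> : sin (B - h - h) =
    sin B - 2 * sin h ^+ 2 * sin B - 2 * sin h * cos h * cos B.
  transitivity (sin B * (cos h ^+ 2 + sin h ^+ 2)
      - 2 * sin h ^+ 2 * sin B - 2 * sin h * cos h * cos B).
    by rewrite !(sinB _ h) !(cosB _ h); ring.
  by rewrite cos2Dsin2 mulr1.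
by rewrite -(natr1 N) (cosD B h) (cosB B h); ring.
Qed.

Definition Dkernel N (g a : R) : R :=
  \sum_(0 <= k < N) k.+1%:R * cos (k.+1%:R * a) * dirichlet (N - k.+1) g.

Lemma sin_cheb_s_Qsum N (th s g : R) :
  sin s * Qsum N th s g = (Dkernel N g (th - s) - Dkernel N g (th + s)) / 2.
Proof.
rewrite /Qsum /Dkernel -sumrB big_distrr/= big_distrl/=; apply: eq_bigr => k _.
have -> : sin s * (k.+1%:R * sin (k.+1%:R * th) * cheb_s s k.+1 *
    dirichlet (N - k.+1) g) =
  k.+1%:R * (sin (k.+1%:R * th) * (cheb_s s k.+1 * sin s)) *
    dirichlet (N - k.+1) g by ring.
rewrite cheb_s_sin mul_sin !mulrBr !mulrDr; lra.
Qed.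

(** The triangle [r <= l] holds at least half of the square, so restricting to it keeps the squared
    logarithm. *)
Lemma sum_square_le (u : nat -> R) d b : (forall i, 0 <= u i) ->
  (\sum_(d <= l < b) u l) ^+ 2 <=
  2 * \sum_(d <= l < b) \sum_(d <= r < l.+1) u l * u r.
Proof.
move=> u0; elim: b => [|b IHb]; first by rewrite !big_geq// expr0n mulr0.
have [db|bd] := leqP d b; last by rewrite !big_geq// expr0n mulr0.
rewrite big_nat_recr//= [in leRHS]big_nat_recr//=.
rewrite [\sum_(d <= r < b.+1) u b * _]big_nat_recr//= -big_distrr/=.
have := sqr_ge0 (u b); move: IHb; set S := \sum_(d <= l < b) u l.
by move: (\sum_(d <= l < b) \sum_(_ <= _ < _) _) => T; lra.
Qed.

Lemma ler_sum_subrange (F : nat -> R) (a b a' b' : nat) :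
  (a <= a')%N -> (a' <= b')%N -> (b' <= b)%N ->
  (forall i, (a <= i < b)%N -> 0 <= F i) ->
  \sum_(a' <= i < b') F i <= \sum_(a <= i < b) F i.
Proof.
move=> aa ab bb F0.
rewrite (big_cat_nat (n := a') (m := a) (p := b))//=; last exact: leq_trans bb.
rewrite (big_cat_nat (n := b') (m := a') (p := b))//= addrCA lerDl addr_ge0//.
  rewrite big_nat sumr_ge0// => i /andP[ai ia]; apply: F0; rewrite ai/=; lia.
rewrite big_nat sumr_ge0// => i /andP[ai ia]; apply: F0; rewrite ia/=; lia.
Qed.

(** * Discrete orthogonality and the value at the constant function *)

Section Orthogonality.
Variable m : nat.
Hypothesis m_gt0 : (0 < m)%N.
Let N := (2 * m + 1)%N.

Lemma sum_cos_theta q : (0 < q < 2 * N)%N ->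
  \sum_(1 <= j < N) cos (q%:R * theta m j) = - (1 + (-1) ^+ q) / 2 :> R.
Proof.
move=> /andP[q0 qN].
have N0 : (0 < N)%N by rewrite /N addn1.
have NR : 0 < N%:R :> R by rewrite ltr0n.
pose x : R := q%:R * pi / N%:R.
have s0 : 0 < sin (x / 2).
  apply: sin_gt0_pi; rewrite /x !divr_gt0 ?mulr_gt0 ?ltr0n ?pi_gt0//=.
  rewrite !ltr_pdivrMr// -mulrA [pi * (2 * _)]mulrC ltr_pM2r ?pi_gt0//.
  by rewrite -natrM ltr_nat.
have dE : dirichlet (2 * m) x = - (-1) ^+ q.
  apply: (mulfI (lt0r_neq0 s0)); rewrite sin_half_dirichlet.
  have -> : (2 * m)%:R * x + x / 2 = - (x / 2) + q%:R * pi.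
    have : N%:R * x = q%:R * pi by rewrite /x mulrC divfK// lt0r_neq0.
    by rewrite /N natrD mulrDl; lra.
  by rewrite sin_natDpi sinN; ring.
have : dirichlet (2 * m) x = 1 + 2 * \sum_(1 <= j < N) cos (q%:R * theta m j).
  rewrite /dirichlet -big_distrr/= /N addn1; congr (1 + 2 * _).
  by apply: eq_bigr => j _; congr cos; rewrite /x /theta; ring.
by rewrite dE; lra.
Qed.

Lemma sum_sin_sin_theta k : (k < N)%N ->
  \sum_(1 <= j < N) sin (theta m j) * sin (k.+1%:R * theta m j) =
  if k == 0%N then N%:R / 2 else 0 :> R.
Proof.
move=> kN.
have -> : \sum_(1 <= j < N) sin (theta m j) * sin (k.+1%:R * theta m j) =
   (\sum_(1 <= j < N) cos (k%:R * theta m j)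
    - \sum_(1 <= j < N) cos (k.+2%:R * theta m j)) / 2 :> R.
  rewrite -sumrB big_distrl/=; apply: eq_bigr => j _.
  rewrite mulrC mul_sin; congr ((cos _ - cos _) / 2).
    by rewrite -(natr1 k); ring.
  by rewrite -(natr1 k.+1); ring.
rewrite (@sum_cos_theta k.+2); last by rewrite /N in kN *; lia.
case: k kN => [|k] kN /=.
  under eq_bigr do rewrite mul0r cos0.
  rewrite big_const_nat iter_addr addr0 /N addnK natrD; lra.
by rewrite sum_cos_theta; [rewrite !exprS; lra|rewrite /N in kN *; lia].
Qed.

Lemma sum_cos_gamma i : (0 < i <= 2 * m)%N ->
  \sum_(0 <= l < 2 * m) cos (i%:R * gamma m l) = 0 :> R.
Proof.
move=> /andP[i0 im].
have m4 : (0 < 4 * m)%N by lia.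
have mR : 0 < (4 * m)%:R :> R by rewrite ltr0n.
pose h : R := i%:R * pi / (4 * m)%:R.
have s0 : 0 < sin h.
  apply: sin_gt0_pi; rewrite /h divr_gt0 ?mulr_gt0 ?ltr0n ?pi_gt0//=.
  rewrite ltr_pdivrMr// [pi * _]mulrC ltr_pM2r ?pi_gt0// ltr_nat; lia.
apply: (mulfI (lt0r_neq0 s0)); rewrite mulr0 big_distrr/=.
rewrite (@telescope_sumr_eq _ _ _ (fun l => sin (2 * l%:R * h) / 2))//.
  have -> : 2 * (2 * m)%:R * h = 0 + i%:R * pi.
    have -> : 2 * (2 * m)%:R = (4 * m)%:R :> R.
      by rewrite -natrM; congr _%:R; lia.
    by rewrite add0r /h mulrC divfK// lt0r_neq0.
  by rewrite sin_natDpi !(mulr0, mul0r) sin0 mulr0 mul0r subrr.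
move=> l _; rewrite mulrC.
have -> : i%:R * gamma m l = (2 * l%:R + 1) * h.
  by rewrite /gamma /h natrD natrM; ring.
rewrite mul_cos_sin mulrBl; congr (sin _ / 2 - sin _ / 2).
  by rewrite -(natr1 l); ring.
by ring.
Qed.

Lemma sum_dirichlet_gamma p : (p <= 2 * m)%N ->
  \sum_(0 <= l < 2 * m) dirichlet p (gamma m l) = (2 * m)%:R :> R.
Proof.
elim: p => [_|p IHp pm].
  under eq_bigr do rewrite dirichlet0.
  by rewrite big_const_nat iter_addr addr0 subn0.
under eq_bigr do rewrite dirichletS.
rewrite big_split/= IHp ?(ltnW pm)// -big_distrr/=.
by rewrite sum_cos_gamma ?mulr0 ?addr0//.
Qed.

(** The sum over [l] keeps only the constant term of each Dirichlet kernel, and the sum over [j]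
    only [k = 0], where [cheb_s s 1 = 1]; this removes the dependence on [s]. *)
Lemma sum_sin_Qsum_eq (s : R) :
  \sum_(1 <= j < N) \sum_(0 <= l < 2 * m)
    sin (theta m j) * Qsum N (theta m j) s (gamma m l) = N%:R * m%:R.
Proof.
have N0 : (0 < N)%N by rewrite /N addn1.
rewrite (eq_bigr (fun j => \sum_(0 <= k < N) (2 * m)%:R *
    (k.+1%:R * cheb_s s k.+1 *
     (sin (theta m j) * sin (k.+1%:R * theta m j))))); last first.
  move=> j _; rewrite -big_distrr/= /Qsum exchange_big/= big_distrr/=.
  apply: eq_big_nat => k /andP[_ kN].
  rewrite -big_distrr/= sum_dirichlet_gamma; last by rewrite /N; lia.
  by ring.
rewrite exchange_big/= (@sum_nat_single _ _ _ _ 0)//.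
  rewrite -big_distrr/= -big_distrr/= sum_sin_sin_theta//= cheb_s1 natrM; lra.
move=> k /andP[_ kN] k0.
by rewrite -big_distrr/= -big_distrr/= sum_sin_sin_theta// (negbTE k0) !mulr0.
Qed.

Lemma lebesgue_function_ge1 : 1 <= @lebesgue_function R m ((1, 0), 1).
Proof.
have mR : 0 < m%:R :> R by rewrite ltr0n.
have NR : 0 < N%:R :> R by rewrite ltr0n /N addn1.
set p : R * R * R := (_, 1).
have <- : \sum_(0 <= nu < N) \sum_(1 <= j < N) \sum_(0 <= l < 2 * m)
    2 * sin (theta m j) * kernelT m nu j l p = 1.
  (* Each direction [nu] contributes [1 / N] to the value at the constant function 1. *)
  rewrite (eq_bigr (fun=> 2 * (2 * m * N ^ 2)%:R^-1 * (N%:R * m%:R)));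
    last first.
    move=> nu _; rewrite -(sum_sin_Qsum_eq (sigma m nu (1, 0))) big_distrr/=.
    apply: eq_bigr => j _; rewrite big_distrr/=; apply: eq_bigr => l _.
    rewrite (@kernelT_Qsum _ _ _ _ _ p 0) ?cos0// addr0 subr0; lra.
  rewrite big_const_nat iter_addr addr0 subn0 -mulr_natl !natrM.
  by field; rewrite !lt0r_neq0.
rewrite /lebesgue_function ler_sum// => nu _.
rewrite big_nat [leRHS]big_nat ler_sum// => j /andP[_ jN].
rewrite ler_sum// => l _; apply: ler_wpM2l; last exact: ler_norm.
by rewrite mulr_ge0// sin_theta_ge0.
Qed.
End Orthogonality.

End LowerKernel.

(** * Asymptotics of the kernel near its singularity *)

Section LowerRegion.
Context {R : realType}.
Implicit Types (x t a c A g th s : R).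

Lemma sum_k_sin_approx A x N : sin (x / 2) != 0 ->
  `|\sum_(0 <= k < N) k.+1%:R * sin (A + k.+1%:R * x)
    + N%:R * cos (A + N%:R * x + x / 2) / (2 * sin (x / 2))|
  <= (2 * sin (x / 2) ^+ 2)^-1.
Proof.
move=> s0; have := sum_k_sin A x N.
set S := \sum_(0 <= k < N) _; set C := cos _; set D := _ - sin A.
move: s0; set s := sin (x / 2) => s0 e.
have D2 : `|D| <= 2.
  by rewrite (le_trans (ler_normB _ _))// lerD// sin_max.
have -> : S + N%:R * C / (2 * s) = D / (4 * s ^+ 2).
  have -> : D = 4 * s ^+ 2 * S + 2 * N%:R * s * C by rewrite e; ring.
  by field.
have s2 : 0 < s ^+ 2 by rewrite exprn_even_gt0.
have s4 : 0 < 4 * s ^+ 2 by rewrite mulr_gt0.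
rewrite normrM normfV (ger0_norm (ltW s4)) ler_pdivrMr//.
have -> : (2 * s ^+ 2)^-1 * (4 * s ^+ 2) = 2 by field.
exact: D2.
Qed.

(** As [N * a] is a multiple of [pi], the leading cosines of [sum_k_sin_approx] at [a - g] and
    [- (a + g)] both reduce to [(-1) ^+ i * cos (a / 2)], so the leading terms combine into a
    difference of reciprocals. *)
Lemma Dkernel_approx N g a (i : nat) : N%:R * a = i%:R * pi ->
  sin ((a - g) / 2) != 0 -> sin ((a + g) / 2) != 0 ->
  `|2 * sin (g / 2) * Dkernel N g a + (-1) ^+ i * N%:R * cos (a / 2) / 2 *
     ((sin ((a - g) / 2))^-1 - (sin ((a + g) / 2))^-1)| <=
  (2 * sin ((a - g) / 2) ^+ 2)^-1 + (2 * sin ((a + g) / 2) ^+ 2)^-1.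
Proof.
move=> Na sx sy; set B := N%:R * g + g / 2.
have h1 := @sum_k_sin_approx B (a - g) N sx.
have := @sum_k_sin_approx B (- (a + g)) N.
rewrite mulNr sinN oppr_eq0 sqrrN => /(_ sy) h2.
apply: le_trans (lerD h1 h2); apply: le_trans (ler_normD _ _).
have -> : cos (B + N%:R * (a - g) + (a - g) / 2) = (-1) ^+ i * cos (a / 2).
  by rewrite -cos_natDpi -Na /B; congr cos; lra.
have -> : cos (B + N%:R * - (a + g) + - ((a + g) / 2)) =
    (-1) ^+ i * cos (a / 2).
  by rewrite -cosN -cos_natDpi -Na /B; congr cos; lra.
rewrite le_eqVlt; apply/orP; left; apply/eqP; congr `|_|.
have -> : 2 * sin (g / 2) * Dkernel N g a =
    \sum_(0 <= k < N) k.+1%:R * sin (B + k.+1%:R * (a - g)) +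
    \sum_(0 <= k < N) k.+1%:R * sin (B + k.+1%:R * - (a + g)).
  rewrite -big_split big_distrr/=; apply: eq_big_nat => k /andP[_ kN].
  transitivity (2 * k.+1%:R * (cos (k.+1%:R * a) *
     (sin (g / 2) * dirichlet (N - k.+1) g))); first by ring.
  rewrite sin_half_dirichlet mul_cos_sin natrB//.
  set u := sin (_ + _); set v := sin (_ - _).
  have -> : u = sin (B + k.+1%:R * (a - g)) by congr sin; rewrite /B; ring.
  have -> : v = - sin (B + k.+1%:R * - (a + g)).
    by rewrite -sinN; congr sin; rewrite /B; ring.
  by lra.
by field; rewrite sx sy.
Qed.

Lemma sin_half_diff a g :
  sin ((a + g) / 2) - sin ((a - g) / 2) = 2 * cos (a / 2) * sin (g / 2).
Proof.
have -> : (a + g) / 2 = a / 2 + g / 2 by lra.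
have -> : (a - g) / 2 = a / 2 - g / 2 by lra.
by rewrite sinD sinB; ring.
Qed.

(** By [sin_half_diff] the difference of reciprocals is [2 cos (a / 2) sin (g / 2) / (sx sy)]. With
    [sy <= 3 sin (g / 2)] and [cos (a / 2) ^ 2 >= 3 / 4] the main term is at least [N / (4 sx)]; the
    error is at most [1 / sx ^ 2 <= N / (8 sx)]. *)
Lemma Dkernel_lower N g a (i : nat) : N%:R * a = i%:R * pi -> 0 <= a <= 1 ->
  0 < sin ((a - g) / 2) <= sin (g / 2) -> 8 <= N%:R * sin ((a - g) / 2) ->
  N%:R / (8 * sin ((a - g) / 2)) <= `|2 * sin (g / 2) * Dkernel N g a|.
Proof.
move=> Na /andP[a0 a1] /andP[sx0 sxg] N8.
have sd := sin_half_diff a g.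
have c0 : 0 <= cos (a / 2).
  by apply: cos_ge0_pihalf; have := @pi_ge2 R => ?; apply/andP; split; lra.
have c2 : 3 / 4 <= cos (a / 2) ^+ 2.
  have a2 : 0 <= a / 2 by lra.
  have h := sin_le a2.
  have h0 : 0 <= sin (a / 2).
    by apply: sin_ge0_pi; have := @pi_ge2 R => ?; apply/andP; split; lra.
  have : sin (a / 2) ^+ 2 <= (1 / 2) ^+ 2.
    by rewrite ler_pXn2r ?nnegrE//; lra.
  by rewrite cos2sin2; lra.
have sg0 : 0 < sin (g / 2) by apply: lt_le_trans sxg.
have sxy : sin ((a - g) / 2) <= sin ((a + g) / 2).
  by rewrite -subr_ge0 sd mulr_ge0 ?mulr_ge0//; exact: ltW.
have sy0 : 0 < sin ((a + g) / 2) by apply: lt_le_trans sxy.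
have := Dkernel_approx Na (lt0r_neq0 sx0) (lt0r_neq0 sy0).
have syg : sin ((a + g) / 2) <= 3 * sin (g / 2).
  have : cos (a / 2) * sin (g / 2) <= 1 * sin (g / 2).
    exact: ler_wpM2r (ltW sg0) _ _ (cos_le1 _).
  by lra.
move: sd syg sxy sy0 sg0 c2 c0 N8 sxg sx0.
set sx := sin ((a - g) / 2); set sy := sin ((a + g) / 2); set sg := sin (g / 2).
set c := cos (a / 2); set D := 2 * sg * _.
move=> sd syg sxy sy0 sg0 c2 c0 N8 sxg sx0.
have n0 : 0 <= N%:R :> R by [].
move: (N%:R : R) N8 n0 => n N8 n0.
set X := _ * _ * _ / 2 * _ => h.
have XE : `|X| = n * (c ^+ 2 * (sg / sy)) / sx.
  have -> : X = (-1) ^+ i * (n * (c ^+ 2 * (sg / sy)) / sx).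
    have e : sx^-1 - sy^-1 = 2 * c * sg / (sx * sy).
      by rewrite -sd; field; rewrite !lt0r_neq0.
    by rewrite /X e; field; rewrite !lt0r_neq0.
  rewrite normrM normrX normrN1 expr1n mul1r ger0_norm//.
  apply: divr_ge0; last exact: ltW.
  by rewrite mulr_ge0// mulr_ge0 ?sqr_ge0// divr_ge0//; exact: ltW.
have XL : n / 4 / sx <= `|X|.
  rewrite XE ler_pM2r ?invr_gt0// ler_wpM2l//.
  have : 3^-1 <= sg / sy by rewrite ler_pdivlMr//; lra.
  move=> h3; have -> : 4^-1 = 3 / 4 * 3^-1 :> R by lra.
  by rewrite ler_pM//; lra.
have eL : (2 * sx ^+ 2)^-1 + (2 * sy ^+ 2)^-1 <= n / 8 / sx.
  have : (2 * sy ^+ 2)^-1 <= (2 * sx ^+ 2)^-1.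
    rewrite lef_pV2 ?posrE ?mulr_gt0 ?exprn_gt0// ler_pM2l//.
    by rewrite ler_pXn2r ?nnegrE//; exact: ltW.
  have : (2 * sx ^+ 2)^-1 *+ 2 <= n / 8 / sx.
    have -> : (2 * sx ^+ 2)^-1 *+ 2 = 1 / sx / sx.
      by rewrite -mulr_natr; field; rewrite lt0r_neq0.
    by rewrite ler_pM2r ?invr_gt0// ler_pdivrMr//; lra.
  by rewrite mulr2n; lra.
have -> : n / (8 * sx) = n / 4 / sx - n / 8 / sx.
  by field; rewrite lt0r_neq0.
have := ler_normB (D + X) D; rewrite addrAC subrr add0r.
by lra.
Qed.

(** Away from the singularities the same difference is [O(sin (g / 2))]; this contribution, taken at
    [th + s], is thus small against the lower bound at [th - s]. *)
Lemma Dkernel_upper N g a (i : nat) : N%:R * a = i%:R * pi ->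
  1 / 4 <= sin ((a - g) / 2) -> 1 / 4 <= sin ((a + g) / 2) ->
  0 <= sin (g / 2) ->
  `|2 * sin (g / 2) * Dkernel N g a| <= 16 * N%:R * sin (g / 2) + 16.
Proof.
move=> Na sx4 sy4 sg0.
have sx0 : 0 < sin ((a - g) / 2) by lra.
have sy0 : 0 < sin ((a + g) / 2) by lra.
have := Dkernel_approx Na (lt0r_neq0 sx0) (lt0r_neq0 sy0).
have := sin_half_diff a g; have := cos_max (a / 2).
move: sx4 sy4 sg0 sx0 sy0.
set sx := sin ((a - g) / 2); set sy := sin ((a + g) / 2); set sg := sin (g / 2).
set c := cos (a / 2); set D := 2 * sg * _ => sx4 sy4 sg0 sx0 sy0 c1 sd.
have n0 : 0 <= N%:R :> R by [].
move: (N%:R : R) n0 => n n0.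
set X := _ * _ * _ / 2 * _ => h.
have ix : sx^-1 <= 4 by rewrite -[4]invrK lef_pV2 ?posrE ?invr_gt0//; lra.
have iy : sy^-1 <= 4 by rewrite -[4]invrK lef_pV2 ?posrE ?invr_gt0//; lra.
have ix0 : 0 <= sx^-1 by rewrite invr_ge0 ltW.
have iy0 : 0 <= sy^-1 by rewrite invr_ge0 ltW.
have XE : `|X| <= 16 * n * sg.
  have -> : X = (-1) ^+ i * (c ^+ 2 * (n * sg * (sx^-1 * sy^-1))).
    have e : sx^-1 - sy^-1 = 2 * c * sg / (sx * sy).
      by rewrite -sd; field; rewrite !lt0r_neq0.
    by rewrite /X e; field; rewrite !lt0r_neq0.
  rewrite normrM normrX normrN1 expr1n mul1r normrM normrX.
  have h0 : 0 <= n * sg * (sx^-1 * sy^-1) by rewrite mulr_ge0 ?mulr_ge0.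
  rewrite (ger0_norm h0).
  apply: (@le_trans _ _ (1 * (n * sg * (sx^-1 * sy^-1)))).
    by rewrite ler_wpM2r// expr_le1.
  rewrite mul1r (_ : 16 * n * sg = n * sg * (4 * 4)); last by ring.
  by rewrite ler_wpM2l ?mulr_ge0// ler_pM.
have e1 (u : R) : 0 < u -> u^-1 <= 4 -> (2 * u ^+ 2)^-1 <= 8.
  move=> u0 u4; rewrite (_ : (2 * u ^+ 2)^-1 = u^-1 * u^-1 / 2); last first.
    by field; rewrite lt0r_neq0.
  have : u^-1 * u^-1 <= 4 * 4 by rewrite ler_pM// invr_ge0 ltW.
  by lra.
have := e1 _ sx0 ix; have := e1 _ sy0 iy.
have := ler_normB (D + X) X; rewrite addrK.
by lra.
Qed.

Lemma norm_Qsum_ge N th s g (i i' : nat) : (11 <= N)%N ->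
  N%:R * (th - s) = i%:R * pi -> N%:R * (th + s) = i'%:R * pi ->
  0 < g <= 1 / 16 -> 0 < th - s - g <= g -> 32 <= N%:R * (th - s - g) ->
  1 / 4 <= sin ((th + s - g) / 2) -> 1 / 4 <= sin ((th + s + g) / 2) ->
  N%:R / (16 * g * (th - s - g)) <= `|Qsum N th s g|.
Proof.
move=> N11 Ni Ni' /andP[g0 g1]; set x := th - s - g => /andP[x0 xg] Nx s1 s2.
have pi2 := @pi_ge2 R.
have hN : 11 <= N%:R :> R by rewrite ler_nat.
have hx : 0 <= x / 2 <= pi / 2 by apply/andP; split; lra.
have sxl := sin_ge_half hx.
have x2 : 0 <= x / 2 by lra. have g2 : 0 <= g / 2 by lra.
have sxu := sin_le x2; have sgu := sin_le g2.
have sxg : sin (x / 2) <= sin (g / 2).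
  rewrite leNgt ltr_sin ?in_itv/= -?leNgt; first by lra.
    by apply/andP; split; lra.
  by apply/andP; split; lra.
have sx0 : 0 < sin (x / 2) by lra.
have sg0 : 0 < sin (g / 2) by lra.
have lo : N%:R / (8 * sin (x / 2)) <= `|2 * sin (g / 2) * Dkernel N g (th - s)|.
  apply: Dkernel_lower Ni _ _ _; rewrite -/x.
  - by rewrite /x in x0 xg *; apply/andP; split; lra.
  - by rewrite sx0.
  - have : N%:R * (x / 4) <= N%:R * sin (x / 2) by apply: ler_wpM2l => //; lra.
    by lra.
have up := Dkernel_upper Ni' s1 s2 (ltW sg0).
have QE := sin_cheb_s_Qsum N th s g.
have Q1 : `|sin s * Qsum N th s g| <= `|Qsum N th s g|.
  by rewrite normrM ler_piMl// sin_max.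
have key : N%:R / (16 * sin (x / 2)) <=
    4 * sin (g / 2) * `|sin s * Qsum N th s g|.
  have e : 4 * sin (g / 2) * (sin s * Qsum N th s g) =
      2 * sin (g / 2) * Dkernel N g (th - s)
      - 2 * sin (g / 2) * Dkernel N g (th + s).
    by rewrite QE; lra.
  rewrite -[4 * sin (g / 2)]ger0_norm -?normrM ?e; last by lra.
  apply: le_trans (lerB_dist _ _).
  have -> : N%:R / (16 * sin (x / 2)) = N%:R / (8 * sin (x / 2))
      - N%:R / (16 * sin (x / 2)) by field; rewrite lt0r_neq0.
  (* At most half of the main term is lost: as both sines are at most [1 / 32], this amounts to
     [N / 4 + 8 <= N], true from [N = 11] on. *)
  rewrite lerB// (le_trans up)// ler_pdivlMr ?mulr_gt0//.
  have : N%:R * sin (g / 2) * sin (x / 2) <= N%:R * 32^-1 * 32^-1.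
    apply: ler_pM; [|exact: ltW| |by lra].
      by apply: mulr_ge0 => //; exact: ltW.
    by apply: ler_wpM2l => //; lra.
  by lra.
apply: le_trans Q1; rewrite ler_pdivrMr ?mulr_gt0//.
move: key; rewrite ler_pdivrMr ?mulr_gt0//.
set q := `|sin s * _|; have q0 : 0 <= q by exact: normr_ge0.
have : q * (sin (g / 2) * sin (x / 2)) <= q * (g / 2 * (x / 2)).
  by apply: ler_wpM2l => //; apply: ler_pM => //; exact: ltW.
by lra.
Qed.

End LowerRegion.

(** * Summation over the singular region *)

Section LowerBound.
Context {R : realType}.

Lemma sin_ge_quarter (f e : R) : pi / 4 <= f <= pi / 2 -> 0 <= e <= 1 / 8 ->
  1 / 4 <= sin (f + e).
Proof.
move=> /andP[f1 f2] /andP[e0 e1]; have pi2 := @pi_ge2 R.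
by have [|h|h] := @sin_ge_half_pi R (f + e); [apply/andP; split; lra|lra|lra].
Qed.

Lemma sigma10 m nu : 0 <= @phi R m nu <= pi -> sigma m nu (1, 0) = @phi R m nu.
Proof. by move=> h; rewrite /sigma/= mul1r mul0r addr0 cosK. Qed.

(** [P] plays the role of [pi] and [w] that of [pi / N]. The spacing [P / (2 m)] of the [gamma]
    nodes exceeds [w] only by the factor [1 + 1 / (2 m)], so [g] is [(l + 1 / 2) w] up to [w / 2],
    and [x] lies between [r w] and [(r + 1 / 2) w]. *)
Lemma region_arith (m l r N w P : R) : 2 <= P -> P <= 4 -> 0 < m ->
  N = 2 * m + 1 -> N * w = P -> 16 <= r -> r <= l -> 32 * (l + 1) <= m ->
  let g := (l + 2^-1) * P / (2 * m) in let x := (l + 1 + r) * w - g in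
  [/\ r * w <= x, 0 < x <= g, g <= 1 / 16, g * x <= 3 * l / m * (6 * r / N)
    & 32 <= N * x].
Proof.
move=> P2 P4 m0 NE Nw r16 rl lm g x.
have N0 : 0 < N by rewrite NE; clear -m0; lra.
have w0 : 0 < w by rewrite -(@pmulr_rgt0 _ N)// Nw; clear -P2; lra.
have lP : (l + 2^-1) * P <= (l + 2^-1) * 4.
  by apply: ler_wpM2l => //; clear -r16 rl; lra.
have rP : (r + 2^-1) * P <= (r + 2^-1) * 4.
  by apply: ler_wpM2l => //; clear -r16; lra.
have l0 : 0 < l + 2^-1 by clear -r16 rl; lra.
have m2 : 0 < 2 * m by rewrite mulr_gt0.
have gm : g <= 3 * l / m.
  rewrite /g ler_pdivrMr// (_ : 3 * l / m * (2 * m) = 6 * l); last first.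
    by field; rewrite lt0r_neq0.
  by clear -lP r16 rl; lra.
have g1 : g <= 1 / 16 by rewrite /g ler_pdivrMr//; clear -lP lm; lra.
have gE : g = (l + 2^-1) * w + (l + 2^-1) / (2 * m) * w.
  by rewrite /g -Nw NE; field; rewrite lt0r_neq0.
have d0 : 0 <= (l + 2^-1) / (2 * m) * w.
  by rewrite mulr_ge0 ?(ltW w0)// divr_ge0// ltW.
have d1 : (l + 2^-1) / (2 * m) * w <= 1 / 2 * w.
  apply: ler_wpM2r; first exact: ltW.
  by rewrite ler_pdivrMr//; clear -lm r16 rl; lra.
have rlw : r * w <= l * w by rewrite ler_pM2r.
have x1 : r * w <= x by rewrite /x gE; clear -d1; lra.
have x2 : x <= (r + 2^-1) * w by rewrite /x gE; clear -d0; lra.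
have rw : 16 * w <= r * w by rewrite ler_pM2r.
have x0 : 0 < x by clear -w0 rw x1; lra.
have xg : x <= g by move: x2; rewrite gE; clear -d0 rlw; move: x => x; lra.
have g0 : 0 < g := lt_le_trans x0 xg.
have xN : x <= 6 * r / N.
  rewrite ler_pdivlMr//; have : x * N <= (r + 2^-1) * w * N by rewrite ler_pM2r.
  have -> : (r + 2^-1) * w * N = (r + 2^-1) * P by rewrite -Nw; ring.
  by clear -rP r16; move: x => x; lra.
split => //; first by rewrite x0.
  by apply: ler_pM => //; exact: ltW.
have : N * (r * w) <= N * x by rewrite ler_pM2l.
have -> : N * (r * w) = r * P by rewrite -Nw; ring.
apply: le_trans; have -> : 32 = 16 * 2 :> R by ring.
by apply: ler_pM.
Qed.

Section Region.
Variable m : nat.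
Let N := (2 * m + 1)%N.
(** The scale of the region: [l < M] forces [gamma m l <= 1 / 16], and [8 * M + 8 <= nu < 16 * M]
    puts [phi m nu] in [[pi / 4, pi / 2]]. *)
Let M := (m %/ 32)%N.

(** This choice of [j] puts [theta m j] about [r] steps beyond [phi m nu + gamma m l], so [x] is of
    size [r / N] and [gamma m l] of size [l / m]. The constant is [1152 = 64 * 3 * 6]. *)
Lemma sin_Qsum_ge nu l r : (8 * M + 8 <= nu < 16 * M)%N ->
  (16 <= l < M)%N -> (16 <= r < l.+1)%N ->
  N%:R ^+ 2 * m%:R / 1152 * (l%:R^-1 * r%:R^-1) <=
  sin (theta m (r + (2 * nu + l.+1))) *
  `|Qsum N (theta m (r + (2 * nu + l.+1)))
      (sigma m nu (1, 0)) (gamma m l)| :> R.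
Proof.
move=> /andP[nu1 nu2] /andP[l1 lM] /andP[r1 rl].
have Mm : (32 * M <= m)%N by rewrite /M; lia.
have mM : (m < 32 * M + 32)%N by rewrite /M; lia.
have m0 : (0 < m)%N by lia.
have N11 : (11 <= N)%N by rewrite /N; lia.
(* The offset [8] in the range of [nu] makes up for the rounding in [M]. *)
have nuN1 : (N <= 8 * nu)%N by rewrite /N; lia.
have nuN2 : (4 * nu <= N)%N by rewrite /N; lia.
have lm32 : (32 * l.+1 <= m)%N by lia.
have mR : 0 < m%:R :> R by rewrite ltr0n.
have pi2 := @pi_ge2 R.
have pi4 : pi < 4 :> R by have := @pihalf_lt2 R; lra.
have NE : N%:R = 2 * m%:R + 1 :> R by rewrite /N natrD natrM.
have NR : 0 < N%:R :> R by rewrite NE; lra.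
have [w Nw] : exists w, N%:R * w = pi :> R.
  by exists (pi / N%:R); rewrite mulrC divfK// lt0r_neq0.
have wE : w = pi / N%:R by rewrite -Nw mulrAC divff ?mul1r// lt0r_neq0.
have w0 : 0 < w by rewrite wE divr_gt0// pi_gt0.
have phE : phi m nu = 2 * nu%:R * w :> R by rewrite /phi wE; ring.
have thE : theta m (r + (2 * nu + l.+1)) = phi m nu + (l%:R + 1 + r%:R) * w.
  rewrite phE /theta -/N; have -> : (r + (2 * nu + l.+1))%:R =
      r%:R + (2 * nu%:R + (l%:R + 1)) :> R by rewrite natrD natrD natrM natr1.
  by rewrite wE; ring.
have l16 : 16 <= l%:R :> R by rewrite ler_nat.
have r16 : 16 <= r%:R :> R by rewrite ler_nat.
have rlR : r%:R <= l%:R :> R by rewrite ler_nat.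
have lm : 32 * (l%:R + 1) <= m%:R :> R by rewrite natr1 -natrM ler_nat.
have gE : gamma m l = (l%:R + 2^-1) * pi / (2 * m%:R) :> R.
  by rewrite /gamma natrD !natrM; field; rewrite lt0r_neq0.
have nu1R : N%:R <= 8 * nu%:R :> R by rewrite -natrM ler_nat.
have nu2R : 4 * nu%:R <= N%:R :> R by rewrite -natrM ler_nat.
have ph1 : pi / 4 <= @phi R m nu <= pi / 2.
  rewrite phE -Nw; have : N%:R * w <= 8 * nu%:R * w by rewrite ler_pM2r.
  have : 4 * nu%:R * w <= N%:R * w by rewrite ler_pM2r.
  by clear; move=> *; apply/andP; split; lra.
have ph2 : 0 <= @phi R m nu <= pi.
  by move: ph1 pi2; clear => /andP[? ?] ?; apply/andP; split; lra.
rewrite (sigma10 ph2).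
set f : R := phi m nu in thE ph1 ph2 phE *.
set g : R := gamma m l in gE *.
set t := theta m _ in thE *.
have [] := region_arith pi2 (ltW pi4) mR NE Nw r16 rlR lm.
rewrite -gE; have -> : (l%:R + 1 + r%:R) * w - g = t - f - g.
  by rewrite thE; clear; ring.
set x := t - f - g => x1 /andP[x0 xg] g16 gx Nx.
have g0 : 0 < g := lt_le_trans x0 xg.
have Q : N%:R / (16 * g * x) <= `|Qsum N t f g|.
  apply: (@norm_Qsum_ge _ _ _ _ _ (l + 1 + r) (4 * nu + (l + 1 + r))).
  - exact: N11.
  - by rewrite thE -Nw natrD natrD; clear; ring.
  - rewrite thE phE -Nw; have -> : (4 * nu + (l + 1 + r))%:R =
      4 * nu%:R + (l%:R + 1 + r%:R) :> R by rewrite natrD natrM natrD natrD.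
    by clear; ring.
  - by rewrite g0.
  - by rewrite -/x x0.
  - exact: Nx.
  - have -> : (t + f - g) / 2 = f + x / 2 by rewrite /x; clear; lra.
    apply: sin_ge_quarter => //; clear -x0 xg g16.
    by move: x x0 xg => x *; apply/andP; split; lra.
  - have -> : (t + f + g) / 2 = f + (x / 2 + g) by rewrite /x; clear; lra.
    apply: sin_ge_quarter => //; clear -x0 xg g16.
    by move: x x0 xg => x *; apply/andP; split; lra.
have st : 1 / 4 <= sin t.
  have -> : t = f + (x + g) by rewrite /x; clear; lra.
  apply: sin_ge_quarter => //; clear -x0 xg g16.
  by move: x x0 xg => x *; apply/andP; split; lra.
have N0 := ltW NR.
apply: (@le_trans _ _ (1 / 4 * (N%:R / (16 * g * x)))); last first.
  apply: ler_pM => //.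
  by apply: divr_ge0 => //; rewrite -mulrA; apply: mulr_ge0 => //;
     apply: mulr_ge0; exact: ltW.
have -> : 1 / 4 * (N%:R / (16 * g * x)) = N%:R / 64 * (g * x)^-1.
  by field; rewrite !lt0r_neq0.
have -> : N%:R ^+ 2 * m%:R / 1152 * (l%:R^-1 * r%:R^-1) =
    N%:R / 64 * (3 * l%:R / m%:R * (6 * r%:R / N%:R))^-1 :> R.
  have l0 : 0 < l%:R :> R := lt_le_trans (ltr0n R 16) l16.
  have r0 : 0 < r%:R :> R := lt_le_trans (ltr0n R 16) r16.
  by field; rewrite !lt0r_neq0.
apply: ler_wpM2l; first by rewrite divr_ge0.
by rewrite lef_pV2 ?posrE// ?(lt_le_trans _ gx)// mulr_gt0.
Qed.

Lemma lebesgue_function_ge : (256 <= M)%N ->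
  m%:R * ln (m%:R + 1) ^+ 2 / (64 * 1152 * 32) <=
  lebesgue_function m ((1, 0), 1) :> R.
Proof.
move=> M256.
have Mm : (32 * M <= m)%N by rewrite /M; lia.
have mM : (m < 32 * M + 32)%N by rewrite /M; lia.
have m0 : (0 < m)%N by lia.
have m64 : (m <= M * 64)%N by lia.
have mM2 : (m.+1 <= M ^ 2)%N by nia.
have MM : (M <= 16 * M - (8 * M + 8))%N by lia.
have MN : (16 * M <= N)%N by rewrite /N; lia.
have M0 : (0 < M)%N by lia.
have M16 : (16 <= M)%N by lia.
have M2m : (M <= 2 * m)%N by lia.
have mR : 0 < m%:R :> R by rewrite ltr0n.
have N0 : (0 < N)%N by rewrite /N addn1.
have NR : 0 < N%:R :> R by rewrite ltr0n.
set p : R * R * R := (_, 1).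
pose K : R := (2 * m * N ^ 2)%:R^-1.
have K0 : 0 <= K by rewrite invr_ge0.
pose F nu l j := sin (theta m j) *
  `|Qsum N (theta m j) (sigma m nu (1, 0)) (gamma m l)| : R.
have F0 nu l j : (1 <= j < N)%N -> 0 <= F nu l j.
  by move=> /andP[_ jN]; rewrite mulr_ge0// sin_theta_ge0.
have E : lebesgue_function m p =
    2 * K * \sum_(0 <= nu < N) \sum_(0 <= l < 2 * m) \sum_(1 <= j < N) F nu l j.
  rewrite big_distrr/=; apply: eq_bigr => nu _.
  rewrite exchange_big big_distrr/=; apply: eq_bigr => l _.
  rewrite big_distrr/=; apply: eq_bigr => j _.
  rewrite (@kernelT_Qsum _ _ _ _ _ p 0) ?cos0// addr0 subr0 -/N -/K.
  set q := Qsum _ _ _ _; have -> : K / 2 * (q + q) = K * q by lra.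
  by rewrite normrM (ger0_norm K0) /F -/q; ring.
pose H : R := \sum_(16 <= l < M) l%:R^-1.
pose c : R := N%:R ^+ 2 * m%:R / 1152.
have c0 : 0 <= c.
  exact: divr_ge0 (mulr_ge0 (sqr_ge0 _) (ltW mR)) (ler0n _ _).
have S : M%:R * (c * (H ^+ 2 / 2)) <=
    \sum_(0 <= nu < N) \sum_(0 <= l < 2 * m) \sum_(1 <= j < N) F nu l j.
  have Fs nu l : 0 <= \sum_(1 <= j < N) F nu l j.
    by rewrite big_nat sumr_ge0// => j; exact: F0.
  apply: (@le_trans _ _ (\sum_(8 * M + 8 <= nu < 16 * M)
      \sum_(0 <= l < 2 * m) \sum_(1 <= j < N) F nu l j)); last first.
    apply: ler_sum_subrange => //; first by lia.
    by move=> nu _; rewrite sumr_ge0.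
  apply: (@le_trans _ _ (\sum_(8 * M + 8 <= nu < 16 * M) c * (H ^+ 2 / 2))).
    rewrite big_const_nat iter_addr addr0 -[leRHS]mulr_natl ler_wpM2r//.
      by rewrite mulr_ge0// divr_ge0// sqr_ge0.
    by rewrite ler_nat.
  rewrite big_nat [leRHS]big_nat ler_sum// => nu nuM.
  apply: (@le_trans _ _ (\sum_(16 <= l < M) \sum_(1 <= j < N) F nu l j));
      last first.
    exact: ler_sum_subrange.
  have := @sum_square_le R (fun l => l%:R^-1) 16 M
    (fun i => ltac:(by rewrite invr_ge0)).
  rewrite -/H => hH.
  apply: (@le_trans _ _ (c * \sum_(16 <= l < M) \sum_(16 <= r < l.+1)
      l%:R^-1 * r%:R^-1)); first by rewrite ler_wpM2l//; lra.
  rewrite big_distrr/= big_nat [leRHS]big_nat ler_sum// => l lM.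
  apply: (@le_trans _ _
    (\sum_(16 + (2 * nu + l.+1) <= j < l.+1 + (2 * nu + l.+1))
      F nu l j)); last first.
    have cN : (l.+1 + (2 * nu + l.+1) <= N)%N.
      by move: nuM lM Mm; rewrite /N; clear; lia.
    apply: ler_sum_subrange => // [|j]; last exact: F0.
    by rewrite leq_add2r leqW//; case/andP: lM.
  rewrite big_addn addnK big_distrr/= big_nat [leRHS]big_nat ler_sum// => r rl.
  exact: sin_Qsum_ge.
(* Starting the harmonic sum at 16 costs a factor 2, as [M >= 16 ^ 2]; replacing [M] by
   [m + 1 <= M ^ 2] costs another 2. *)
have HL : ln (m%:R + 1) / 4 <= H.
  have MR : 0 < M%:R :> R by rewrite ltr0n.
  apply: (@le_trans _ _ (ln (M%:R / 16%:R))); last first.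
    exact: ln_le_harmonic.
  have h1 : ln M%:R <= 2 * ln (M%:R / 16%:R) :> R.
    rewrite mulr_natl -lnXn ?divr_gt0// ler_ln ?posrE ?exprn_gt0 ?divr_gt0//.
    rewrite expr_div_n ler_pdivlMr// expr2 ler_pM2l// -natrM ler_nat.
    exact: leq_trans M256.
  have h2 : ln (m%:R + 1) <= 2 * ln M%:R :> R.
    rewrite mulr_natl -lnXn// ler_ln ?posrE ?exprn_gt0 ?addr_gt0//.
    by rewrite natr1 -natrX ler_nat.
  by lra.
have L0 : 0 <= ln (m%:R + 1) :> R by rewrite ln_ge0// lerDr.
rewrite E; apply: (@le_trans _ _ (2 * K * (M%:R * (c * (H ^+ 2 / 2)))));
  last first.
  by apply: ler_wpM2l => //; exact: mulr_ge0.
have -> : 2 * K * (M%:R * (c * (H ^+ 2 / 2))) = M%:R * (H ^+ 2 / 2304).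
  by rewrite /K /c !natrM; field; rewrite !lt0r_neq0.
have HH : (ln (m%:R + 1) / 4) ^+ 2 <= H ^+ 2.
  by rewrite ler_pXn2r ?nnegrE ?divr_ge0// (le_trans _ HL)// divr_ge0.
have -> : m%:R * ln (m%:R + 1) ^+ 2 / (64 * 1152 * 32) =
  m%:R / 64 * ((ln (m%:R + 1) / 4) ^+ 2 / 2304) :> R by field.
apply: ler_pM.
- by rewrite divr_ge0.
- exact: divr_ge0 (sqr_ge0 _) (ler0n _ _).
- by rewrite ler_pdivrMr// -natrM ler_nat.
- by apply: ler_wpM2r HH; rewrite invr_ge0 ler0n.
Qed.

End Region.
End LowerBound.

Lemma lebesgue_function_lower (R : realType) : exists2 c : R, 0 < c &
  forall m, c * m%:R * ln (m%:R + 1) ^+ 2 <= lebesgue_function m ((1, 0), 1).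
Proof.
(* An upper bound for the finitely many small [m]; there [ln (m + 1) <= m] yields the bound
   [k ^ 3]. *)
have [k k0 mk] : exists2 k, (0 < k)%N &
    forall m, (m %/ 32 < 256)%N -> (m <= k)%N.
  by exists (32 * 256)%N => // m; lia.
set A : R := 64 * 1152 * 32; set B : R := k%:R ^+ 3.
have A1 : 1 <= A by rewrite /A -!natrM ler1n !muln_gt0.
have B1 : 1 <= B by rewrite exprn_ege1// ler1n.
have lower m : (256 <= m %/ 32)%N ->
    m%:R * ln (m%:R + 1) ^+ 2 / A <= lebesgue_function m ((1, 0), 1) :> R.
  exact: lebesgue_function_ge.
have small m : (m %/ 32 < 256)%N -> m%:R * ln (m%:R + 1) ^+ 2 <= B :> R.
  move=> m256; have mB : m%:R <= k%:R :> R by rewrite ler_nat mk.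
  have L1 : ln (m%:R + 1) <= m%:R :> R.
    by rewrite addrC le_ln1Dx// (lt_le_trans (ltrN10 _)).
  have L0 : 0 <= ln (m%:R + 1) :> R by rewrite ln_ge0// lerDr.
  rewrite /B (exprS k%:R 2); apply: ler_pM => //; first exact: sqr_ge0.
  by rewrite ler_pXn2r ?nnegrE// (le_trans L1).
move: A B A1 B1 lower small => A B A1 B1 lower small.
have A0 : 0 < A by exact: lt_le_trans A1.
have B0 : 0 < B by exact: lt_le_trans B1.
(* [A^-1] serves the large [m] and [B^-1] the small ones, where the Lebesgue function is at least 1;
   the product serves both since [A] and [B] are at least 1. *)
exists (A^-1 * B^-1) => [|m]; first by rewrite mulr_gt0 ?invr_gt0.
have Ai : 0 <= A^-1 by rewrite invr_ge0 ltW.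
have Bi : 0 <= B^-1 by rewrite invr_ge0 ltW.
have L0 : 0 <= m%:R * ln (m%:R + 1) ^+ 2 :> R by rewrite mulr_ge0// sqr_ge0.
set X := m%:R * _ in L0; rewrite -[leLHS]mulrA -/X.
have [m256|m256] := leqP 256 (m %/ 32).
  apply: le_trans (lower m m256); rewrite -/X.
  have -> : A^-1 * B^-1 * X = X / A * B^-1 by ring.
  by apply: ler_piMr; [exact: mulr_ge0|rewrite invf_le1].
have [m00|m0] := posnP m.
  rewrite /X m00 mul0r mulr0; apply: sumr_ge0 => nu _.
  by rewrite [\sum_(1 <= _ < _) _]big_geq.
apply: le_trans (@lebesgue_function_ge1 R m m0).
have -> : A^-1 * B^-1 * X = A^-1 * (X / B) by ring.
apply: mulr_ile1 => //; [exact: mulr_ge0|by rewrite invf_le1|].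
by rewrite ler_pdivrMr// mul1r; exact: small.
Qed.

Theorem theorem3p8 (R : realType) :
  exists c1 c2 : R, [/\ 0 < c1, 0 < c2 &
    forall m : nat,
      ((c1 * m%:R * ln (m%:R + 1) ^+ 2)%:E
         <= op_norm (cylinder R) (calB m))%E /\
      (op_norm (cylinder R) (calB m)
         <= (c2 * m%:R * ln (m%:R + 1) ^+ 2)%:E)%E].
Proof.
have [c1 c1_gt0 lower] := lebesgue_function_lower R.
exists c1, (1152 * 36 * 144); split; first exact: c1_gt0.
  by apply: mulr_gt0; first apply: mulr_gt0; rewrite ltr0n.
move=> m; split.
  apply: (@le_trans _ _ (lebesgue_function m ((1, 0), 1))%:E).
    by rewrite lee_fin.
  apply: op_norm_ge_lebesgue_function; split; rewrite /disk/=.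
    by rewrite expr1n expr0n addr0.
  by rewrite lexx andbT; lra.
(* For [m = 0] the Lebesgue function is an empty sum and the bound is 0. *)
have [->|m0] := posnP m; last first.
  by apply: op_norm_calB_le => p; exact: lebesgue_function_le.
apply: op_norm_calB_le => p _; rewrite mulr0 mul0r.
by rewrite /lebesgue_function big1// => nu _; rewrite big_geq.
Qed.
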